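(* Let $\Gamma\in C_b^2(\mathbb R)$ be $2\pi$-periodic and $H\in C_b^3(\mathbb R^2)$ be $2\pi$-periodic in each argument. Define $$F(u,v,w):=-\Gamma(v-u)\,\partial_1H(u,v)\,H(u,w)\,\Gamma(w-u)-\Gamma(v-u)\,\partial_2H(u,v)\,H(v,w)\,\Gamma(w-v),$$ so that the triplet operator is $$T[\theta](x)=\int_0^1\!\int_0^1F(\theta(x),\theta(y),\theta(z))\,dz\,dy.$$ If there exist $u_*,v_*,w_*\in\mathbb R$ such that $$M(u_*,v_*,w_* ):=\partial_v\partial_wF(u_*,v_*,w_* )+\partial_v\partial_wF(u_*,w_*,v_* )\neq0,$$ where $\partial_v\partial_wF$ denotes the mixed partial derivative of $F$ in its second and third arguments (evaluated at the indicated points), then $T:C([0,1])\to C([0,1])$ is genuinely nonpairwise. In particular, $T:L^\infty([0,1])\to L^\infty([0,1])$ is not pairwise-representable either within the same kernel class: there is no kernel $\kappa$ satisfying the regularity and boundedness conditions of the definition of pairwise-representability such that $T[\theta](x)=\int_0^1\kappa(\theta(x),\theta(y);x,y)\,dy$ for all $\theta\in L^\infty([0,1])$ (as an identity in $L^\infty([0,1])$).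
   Context: $C_b^k$ denotes $C^k$ functions bounded together with all partial derivatives up to order $k$; $C([0,1])$ carries the supremum norm. Pairwise representability: a $C^2$ map $V:C([0,1])\to C([0,1])$ is pairwise-representable if there exists a jointly measurable kernel $\kappa:\mathbb R^2\times[0,1]^2\to\mathbb R$ such that for every $(x,y)\in[0,1]^2$ the map $(u,v)\mapsto\kappa(u,v;x,y)$ belongs to $C^2(\mathbb R^2)$, its partial derivatives up to order two are bounded uniformly in $(x,y)$, and $$V[\theta](x)=\int_0^1\kappa(\theta(x),\theta(y);x,y)\,dy\quad\text{for all }\theta\in C([0,1]),\ x\in[0,1].$$ If no such kernel exists, $V$ is called genuinely nonpairwise. *)

(* Defs.v *)
From HB Require Import structures.
From mathcomp Require Export all_boot all_order all_algebra.
From mathcomp Require Export all_classical all_reals all_analysis.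

Set Implicit Arguments.
Unset Strict Implicit.
Unset Printing Implicit Defensive.

Import Order.TTheory GRing.Theory Num.Theory.
Import numFieldNormedType.Exports.

Local Open Scope classical_set_scope.
Local Open Scope ring_scope.

Section Smoothness.
Context {R : realType}.
Implicit Types (g : R -> R) (f : R -> R -> R).

Definition Cb_fun1 (k : nat) g : Prop :=
  (forall i : nat, (i < k)%N -> forall t, derivable (derive1n i g) t 1) /\
  (forall i : nat, (i <= k)%N ->
    continuous (derive1n i g) /\ exists B : R, forall t, `|derive1n i g t| <= B).

Definition pd1 f : R -> R -> R := partial1of2 f.
Definition pd2 f : R -> R -> R := fun u => derive1 (f u).

Fixpoint C_fun2 (k : nat) f : Prop :=
  continuous (fun p : R * R => f p.1 p.2) /\
  if k is k'.+1 then
    [/\ forall u v, derivable (fun t => f t v) u 1,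
        forall u v, derivable (fun t => f u t) v 1,
        C_fun2 k' (pd1 f) & C_fun2 k' (pd2 f)]
  else True.

(* Every partial derivative of f of order between 1 and k is bounded by B;
   f itself need not be bounded. *)
Fixpoint pd_bounded (k : nat) (B : R) f : Prop :=
  if k is k'.+1 then
    [/\ forall u v, `|pd1 f u v| <= B, forall u v, `|pd2 f u v| <= B,
        pd_bounded k' B (pd1 f) & pd_bounded k' B (pd2 f)]
  else True.

Definition Cb_fun2 (k : nat) f : Prop :=
  C_fun2 k f /\ exists B : R, (forall u v, `|f u v| <= B) /\ pd_bounded k B f.

End Smoothness.

Section FunctionSpaces.
Context {R : realType}.
Implicit Types (f g h : R -> R).

Definition I01 : set R := `[0, 1]%classic.

(* C([0,1]) and L^oo([0,1]) are represented by functions on R of which only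
   the values on [0,1] (for L^oo, up to a null set) are relevant. *)
Definition C01 : set (R -> R) := [set f | {within I01, continuous f}].

Definition norm01 f : R := sup [set `|f x| | x in I01].

Definition bounded_linear01 (A : (R -> R) -> (R -> R)) : Prop :=
  [/\ forall f, C01 f -> C01 (A f),
      forall (a : R) f g, C01 f -> C01 g -> forall x, I01 x ->
        A (fun t => a * f t + g t) x = a * A f x + A g x
    & exists B : R, forall f, C01 f -> norm01 (A f) <= B * norm01 f].

Definition bounded_bilinear01 (A : (R -> R) -> (R -> R) -> (R -> R)) : Prop :=
  [/\ forall f, C01 f -> bounded_linear01 (A f),
      forall g, C01 g -> bounded_linear01 (fun f => A f g)
    & exists B : R, forall f g, C01 f -> C01 g ->
        norm01 (A f g) <= B * norm01 f * norm01 g].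

(* Twice continuously Frechet differentiable self-maps of C([0,1]): the second
   derivative is that of DV for the operator norm, and is itself continuous for
   the norm of bounded bilinear maps. *)
Definition C2_map01 (V : (R -> R) -> (R -> R)) : Prop :=
  (forall f, C01 f -> C01 (V f)) /\
  exists (DV : (R -> R) -> (R -> R) -> (R -> R))
         (D2V : (R -> R) -> (R -> R) -> (R -> R) -> (R -> R)),
  [/\ forall f, C01 f -> bounded_linear01 (DV f),
      forall f, C01 f -> bounded_bilinear01 (D2V f),
      forall f, C01 f -> forall e : R, 0 < e -> exists2 d : R, 0 < d &
        forall h, C01 h -> norm01 h < d ->
          norm01 (fun x => V (f \+ h) x - V f x - DV f h x) <= e * norm01 h,
      forall f, C01 f -> forall e : R, 0 < e -> exists2 d : R, 0 < d &
        forall h, C01 h -> norm01 h < d -> forall g, C01 g ->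
          norm01 (fun x => DV (f \+ h) g x - DV f g x - D2V f h g x)
            <= e * norm01 h * norm01 g
    & forall f, C01 f -> forall e : R, 0 < e -> exists2 d : R, 0 < d &
        forall h, C01 h -> norm01 h < d -> forall g1 g2, C01 g1 -> C01 g2 ->
          norm01 (fun x => D2V (f \+ h) g1 g2 x - D2V f g1 g2 x)
            <= e * norm01 g1 * norm01 g2].

Definition mu01 : {measure set (measurableTypeR R) -> \bar R} :=
  mrestr (@lebesgue_measure R) (measurable_itv `[0%R, 1%R]).

Definition Linf01 : set (R -> R) := [set f | f \in Lfun mu01 +oo%E].

Definition Linf_map01 (V : (R -> R) -> (R -> R)) : Prop :=
  (forall f, Linf01 f -> Linf01 (V f)) /\
  (forall f g, Linf01 f -> Linf01 g ->
    ae_eq lebesgue_measure I01 f g -> ae_eq lebesgue_measure I01 (V f) (V g)).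

End FunctionSpaces.

Section Pairwise.
Context {R : realType}.
Local Notation mu := (@lebesgue_measure R).

(* kappa u v x y stands for kappa(u, v; x, y). *)
Definition pairwise_kernel (kappa : R -> R -> R -> R -> R) : Prop :=
  [/\ measurable_fun ([set: R * R] `*` (I01 `*` I01))
        (fun p : (R * R) * (R * R) => kappa p.1.1 p.1.2 p.2.1 p.2.2),
      forall x y, I01 x -> I01 y -> C_fun2 2 (fun u v => kappa u v x y)
    & exists B : R, forall x y, I01 x -> I01 y ->
        pd_bounded 2 B (fun u v => kappa u v x y)].

Definition pairwise_integrable (kappa : R -> R -> R -> R -> R) (f : R -> R)
    (x : R) : Prop :=
  mu.-integrable I01 (fun y => (kappa (f x) (f y) x y)%:E).

Definition pairwise_op (kappa : R -> R -> R -> R -> R) (f : R -> R) : R -> R :=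
  fun x => \int[mu]_(y in I01) kappa (f x) (f y) x y.

(* As kappa itself need not be bounded, the existence of the integrals is
   part of the representation. *)
Definition has_pairwise_kernel (V : (R -> R) -> (R -> R)) : Prop :=
  exists kappa, pairwise_kernel kappa /\
    forall f, C01 f -> forall x, I01 x ->
      pairwise_integrable kappa f x /\ V f x = pairwise_op kappa f x.

Definition has_pairwise_kernel_Linf (V : (R -> R) -> (R -> R)) : Prop :=
  exists kappa, pairwise_kernel kappa /\
    forall f, Linf01 f ->
      {ae mu, forall x, I01 x -> pairwise_integrable kappa f x} /\
      ae_eq mu I01 (V f) (pairwise_op kappa f).

Definition pairwise_representable (V : (R -> R) -> (R -> R)) : Prop :=
  C2_map01 V /\ has_pairwise_kernel V.

Definition genuinely_nonpairwise (V : (R -> R) -> (R -> R)) : Prop :=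
  C2_map01 V /\ ~ pairwise_representable V.

End Pairwise.

Section Triplet.
Context {R : realType} (Gamma : R -> R) (H : R -> R -> R).

Definition tripletF (u v w : R) : R :=
  - (Gamma (v - u) * pd1 H u v * H u w * Gamma (w - u))
  - Gamma (v - u) * pd2 H u v * H v w * Gamma (w - v).

Definition tripletM (u v w : R) : R :=
  pd1 (pd2 (tripletF u)) v w + pd1 (pd2 (tripletF u)) w v.

Definition tripletT (theta : R -> R) : R -> R := fun x =>
  \int[lebesgue_measure]_(y in I01)
    \int[lebesgue_measure]_(z in I01) tripletF (theta x) (theta y) (theta z).

End Triplet.

(* Main.v *)
Require Import Defs.
From mathcomp Require Import all_boot all_order all_algebra.
From mathcomp Require Import all_classical all_reals all_analysis.
From mathcomp Require Import measurable_realfun ess_sup_inf.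
From mathcomp Require Import ring lra.
Import Order.TTheory GRing.Theory Num.Theory.
Import numFieldNormedType.Exports.
Local Open Scope ring_scope.
Local Open Scope classical_set_scope.

Set Implicit Arguments.
Unset Strict Implicit.
Unset Printing Implicit Defensive.

(** The obstruction to pairwise representability is a mixed second difference.
Let [base] be a continuous function equal to [u] on [0,1/5], to [v] on
[2/5,3/5] and to [w] on [4/5,1], and let [h], [k] be small nonnegative bumps
supported in the second and in the third interval. Fix [x] in [0,1/5] and
consider the combination

  V[base + h + k](x) - V[base + h](x) - V[base + k](x) + V[base](x).

If [V] is an integral of kappa(theta(x), theta(y); x, y) over [y], this vanishes:
the four functions agree at [x], and at each [y] at least one of [h], [k] is
zero, so that the integrand itself cancels ([pairwise_second_difference]). For
the triplet operator the integrand depends on two points, and those pairs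
(y,z) with one point in each bump survive. By the mean value theorem their
contribution is M(u,v,w) times the product of the integrals of [h] and [k], up
to a relative error which is small with the bumps, hence it is nonzero when
M(u,v,w) is ([second_difference_probes]). The four functions are continuous and
bounded, and the two results disagree for all [x] in an interval of positive
length; the same argument therefore excludes an identity that holds only almost
everywhere, which is the L^oo statement.

That the triplet operator is of class C^2 on C([0,1]) comes from F being of
class C_b^2 on R^3, a class closed under products and sums
([tripletF_Cb_fun3]). The candidate derivatives of theta |-> (x |-> average over
(y,z) of F(theta(x), theta(y), theta(z))) are the averages of the partial
derivatives of F against the values of the directions at x, y, z. As theta takes
its values in a compact interval, the first order Taylor estimate for F and for
its first derivatives, and the continuity of the second derivatives, hold
uniformly along theta; integrating gives the three Frechet conditions
([mean2_lift3_C2]).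

On L^oo the points to check are that the image of a function is measurable,
by Tonelli's theorem and because continuous functions on R^3 are measurable for
the product sigma-algebra, that it is bounded, as F is, and that it depends on
the function only up to null sets ([mean2_lift3_Linf]). *)

(** * Functions of three variables of class C_b^k *)

Section ThreeVariables.
Context {R : realType}.
Implicit Types (G : R * R * R -> R) (p q : R * R * R).

Definition partials G G1 G2 G3 : Prop := forall u v w : R,
  [/\ is_derive u 1 (fun t => G (t, v, w)) (G1 (u, v, w)),
      is_derive v 1 (fun t => G (u, t, w)) (G2 (u, v, w))
    & is_derive w 1 (fun t => G (u, v, t)) (G3 (u, v, w))].

(** The partial derivatives are asserted to exist rather than named by an
operator, so that closure under products is an induction with no formula for
iterated derivatives. *)
Fixpoint Cb_fun3 (k : nat) G : Prop :=
  [/\ continuous G, exists B : R, forall p, `|G p| <= B &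
  if k is k'.+1 then
    exists G1 G2 G3, partials G G1 G2 G3 /\
      [/\ Cb_fun3 k' G1, Cb_fun3 k' G2 & Cb_fun3 k' G3]
  else True].

Lemma Cb_fun3_cont k G : Cb_fun3 k G -> continuous G.
Proof. by case: k => [|k] []. Qed.

Lemma Cb_fun3_bounded k G : Cb_fun3 k G -> exists B : R, forall p, `|G p| <= B.
Proof. by case: k => [|k] []. Qed.

Lemma Cb_fun3_partials k G : Cb_fun3 k.+1 G ->
  exists G1 G2 G3, [/\ partials G G1 G2 G3, Cb_fun3 k G1, Cb_fun3 k G2
    & Cb_fun3 k G3].
Proof. by case=> _ _ [G1 [G2 [G3 [dG [C1 C2 C3]]]]]; exists G1, G2, G3. Qed.

Lemma Cb_fun3S k G : Cb_fun3 k.+1 G -> Cb_fun3 k G.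
Proof.
elim: k G => [|k IH] G; first by case=> cG bG _; split.
case=> cG bG [G1 [G2 [G3 [dG [C1 C2 C3]]]]]; split=> //.
by exists G1, G2, G3; split=> //; split; apply: IH.
Qed.

Lemma Cb_fun3_cst k (c : R) : Cb_fun3 k (fun=> c).
Proof.
elim: k c => [|k IH] c.
  by split=> //; [move=> x; exact: cvg_cst | exists `|c|].
split; [by move=> x; exact: cvg_cst | by exists `|c| |].
exists (fun=> 0), (fun=> 0), (fun=> 0); split => [u v w|]; last by split.
by split; exact: is_derive_cst.
Qed.

Lemma Cb_fun3D k G G' :
  Cb_fun3 k G -> Cb_fun3 k G' -> Cb_fun3 k (fun p => G p + G' p).
Proof.
elim: k G G' => [|k IH] G G' [cG [B bG] dG] [cG' [B' bG'] dG']; split=> //.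
- by move=> x; apply: cvgD; [exact: cG|exact: cG'].
- by exists (B + B') => p; rewrite (le_trans (ler_normD _ _))// lerD.
- by move=> x; apply: cvgD; [exact: cG|exact: cG'].
- by exists (B + B') => p; rewrite (le_trans (ler_normD _ _))// lerD.
move: dG dG' => [G1 [G2 [G3 [dG [C1 C2 C3]]]]] [G1' [G2' [G3' [dG' [C1' C2' C3']]]]].
exists (fun p => G1 p + G1' p), (fun p => G2 p + G2' p), (fun p => G3 p + G3' p).
split; last by split; apply: IH.
move=> u v w; have [? ? ?] := dG u v w; have [? ? ?] := dG' u v w.
by split; exact: is_deriveD.
Qed.

Lemma Cb_fun3M k G G' :
  Cb_fun3 k G -> Cb_fun3 k G' -> Cb_fun3 k (fun p => G p * G' p).
Proof.
elim: k G G' => [|k IH] G G' CG CG'; split.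
- by move=> x; apply: cvgM; [exact: (Cb_fun3_cont CG)|exact: (Cb_fun3_cont CG')].
- have [[B bG] [B' bG']] := (Cb_fun3_bounded CG, Cb_fun3_bounded CG').
  by exists (B * B') => p; rewrite normrM ler_pM.
- by [].
- by move=> x; apply: cvgM; [exact: (Cb_fun3_cont CG)|exact: (Cb_fun3_cont CG')].
- have [[B bG] [B' bG']] := (Cb_fun3_bounded CG, Cb_fun3_bounded CG').
  by exists (B * B') => p; rewrite normrM ler_pM.
move: (Cb_fun3S CG) (Cb_fun3S CG') => sG sG'.
case: CG => _ _ [G1 [G2 [G3 [dG [C1 C2 C3]]]]].
case: CG' => _ _ [G1' [G2' [G3' [dG' [C1' C2' C3']]]]].
exists (fun p => G p * G1' p + G' p * G1 p), (fun p => G p * G2' p + G' p * G2 p),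
  (fun p => G p * G3' p + G' p * G3 p).
split; last by split; apply: Cb_fun3D; apply: IH.
move=> u v w; have [? ? ?] := dG u v w; have [? ? ?] := dG' u v w.
by split; exact: is_deriveM.
Qed.

Lemma Cb_fun3N k G : Cb_fun3 k G -> Cb_fun3 k (fun p => - G p).
Proof.
move=> CG; rewrite (_ : (fun p => _) = (fun p => (-1) * G p)); last first.
  by apply/funext => p; rewrite mulN1r.
exact/Cb_fun3M/CG/Cb_fun3_cst.
Qed.

Lemma Cb_fun1_derive1 k (g : R -> R) : Cb_fun1 k.+1 g ->
  (forall t : R, is_derive t 1 g (derive1 g t)) /\ Cb_fun1 k (derive1 g).
Proof.
case=> dg bg; split.
  by move=> t; rewrite derive1E; apply: derivableP; exact: (dg 0%N).
by split=> i ik; rewrite -derive1Sn; [apply: dg | apply: bg].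
Qed.

(** Gives the factors Gamma(v - u), Gamma(w - u) and Gamma(w - v) of F. *)
Lemma Cb_fun3_linear k (g : R -> R) (a b c : R) : Cb_fun1 k g ->
  Cb_fun3 k (fun p => g (a * p.1.1 + b * p.1.2 + c * p.2)).
Proof.
have lin_cont : continuous (fun p : R * R * R => a * p.1.1 + b * p.1.2 + c * p.2).
  move=> p; apply: cvgD; first apply: cvgD; apply: cvgM; try exact: cvg_cst.
  - exact: (cvg_comp _ _ cvg_fst cvg_fst).
  - exact: (cvg_comp _ _ cvg_fst cvg_snd).
  - exact: cvg_snd.
elim: k g => [|k IH] g Cg; have [cg [B bg]] := Cg.2 0%N isT; split=> //.
- by move=> p; apply: (continuous_comp (lin_cont p)); exact: cg.
- by exists B => p; exact: bg.
- by move=> p; apply: (continuous_comp (lin_cont p)); exact: cg.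
- by exists B => p; exact: bg.
have [dg /IH Cdg] := Cb_fun1_derive1 Cg.
exists (fun p => a * derive1 g (a * p.1.1 + b * p.1.2 + c * p.2)),
  (fun p => b * derive1 g (a * p.1.1 + b * p.1.2 + c * p.2)),
  (fun p => c * derive1 g (a * p.1.1 + b * p.1.2 + c * p.2)).
split; last by split; apply: Cb_fun3M => //; exact: Cb_fun3_cst.
have chain (L : R -> R) (t l : R) : is_derive t 1 L l ->
    is_derive t 1 (fun s => g (L s)) (l * derive1 g (L t)).
  by move=> dL; rewrite mulrC; refine (is_derive1_comp (dg (L t)) dL).
have affine (L : R -> R) (m n t : R) : (forall s, L s = n + m * s) ->
    is_derive t 1 L m.
  move=> LE; rewrite (_ : L = cst n + m *: id); last by apply/funext.
  have := is_deriveD (is_derive_cst n t 1) (is_deriveZ m (is_derive_id t 1)).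
  by rewrite add0r /GRing.scale/= mulr1.
move=> u v w; split => /=.
- apply: (chain (fun t => a * t + b * v + c * w)).
  by apply: (affine _ _ (b * v + c * w)) => t; lra.
- apply: (chain (fun t => a * u + b * t + c * w)).
  by apply: (affine _ _ (a * u + c * w)) => t; lra.
- apply: (chain (fun t => a * u + b * v + c * t)).
  exact: (affine _ _ (a * u + b * v)).
Qed.

Lemma Cb_fun2S k (f : R -> R -> R) : Cb_fun2 k.+1 f ->
  [/\ forall u v : R, is_derive u 1 (f ^~ v) (pd1 f u v),
      forall u v : R, is_derive v 1 (f u) (pd2 f u v),
      Cb_fun2 k (pd1 f) & Cb_fun2 k (pd2 f)].
Proof.
case=> [[cf [d1 d2 C1 C2]] [B [bf [b1 b2 B1 B2]]]]; split.
- by move=> u v; rewrite /pd1 partial1of2E; apply: derivableP; exact: d1.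
- by move=> u v; rewrite /pd2 derive1E; apply: derivableP; exact: d2.
- by split=> //; exists B.
- by split=> //; exists B.
Qed.

Lemma Cb_fun2_cont k (f : R -> R -> R) : Cb_fun2 k f ->
  continuous (fun p : R * R => f p.1 p.2).
Proof. by case: k => [|k] [] []. Qed.

Lemma Cb_fun2_bounded k (f : R -> R -> R) : Cb_fun2 k f ->
  exists B : R, forall u v, `|f u v| <= B.
Proof. by move=> [_ [B [bf _]]]; exists B. Qed.

Lemma Cb_fun2W k (f : R -> R -> R) : Cb_fun2 k.+1 f -> Cb_fun2 k f.
Proof.
move=> [Cf [B [bf pf]]]; split; last exists B; last (split; first exact: bf).
- elim: k f {B bf pf} Cf => [|k IH] f [cf [d1 d2 C1 C2]]; split; try exact: cf.
    exact: I.
  by split; [exact d1|exact d2|exact (IH _ C1)|exact (IH _ C2)].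
- elim: k f {Cf bf} pf => [|k IH] f [b1 b2 B1 B2]; first exact: I.
  by split; [exact b1|exact b2|exact (IH _ B1)|exact (IH _ B2)].
Qed.

Lemma cvg_pair_comp (f : R -> R -> R) (P Q : R * R * R -> R) :
  continuous (fun p : R * R => f p.1 p.2) -> continuous P -> continuous Q ->
  continuous (fun p => f (P p) (Q p)).
Proof.
move=> cf cP cQ p.
have cPQ : {for p, continuous (fun p => (P p, Q p))} by exact: cvg_pair (cP p) (cQ p).
have := continuous_comp cPQ (cf (P p, Q p)); exact.
Qed.

Lemma continuous_proj3 : [/\ continuous (fun p : R * R * R => p.1.1),
  continuous (fun p : R * R * R => p.1.2) & continuous (fun p : R * R * R => p.2)].
Proof.
split=> p; last exact: cvg_snd.
- exact: (cvg_comp _ _ cvg_fst cvg_fst).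
- exact: (cvg_comp _ _ cvg_fst cvg_snd).
Qed.

Lemma Cb_fun3_12 k (f : R -> R -> R) : Cb_fun2 k f ->
  Cb_fun3 k (fun p => f p.1.1 p.1.2).
Proof.
have [c1 c2 c3] := continuous_proj3.
elim: k f => [|k IH] f Cf; (split; [exact/cvg_pair_comp/c2/c1/(Cb_fun2_cont Cf)|
  by have [B bf] := Cb_fun2_bounded Cf; exists B | ]) => //.
have [d1 d2 C1 C2] := Cb_fun2S Cf.
exists (fun p => pd1 f p.1.1 p.1.2), (fun p => pd2 f p.1.1 p.1.2), (fun=> 0).
split; last by split; [exact: IH|exact: IH|exact: Cb_fun3_cst].
by move=> u v w; split; [exact: d1|exact: d2|exact: (is_derive_cst (f u v))].
Qed.

Lemma Cb_fun3_13 k (f : R -> R -> R) : Cb_fun2 k f ->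
  Cb_fun3 k (fun p => f p.1.1 p.2).
Proof.
have [c1 c2 c3] := continuous_proj3.
elim: k f => [|k IH] f Cf; (split; [exact/cvg_pair_comp/c3/c1/(Cb_fun2_cont Cf)|
  by have [B bf] := Cb_fun2_bounded Cf; exists B | ]) => //.
have [d1 d2 C1 C2] := Cb_fun2S Cf.
exists (fun p => pd1 f p.1.1 p.2), (fun=> 0), (fun p => pd2 f p.1.1 p.2).
split; last by split; [exact: IH|exact: Cb_fun3_cst|exact: IH].
by move=> u v w; split; [exact: d1|exact: (is_derive_cst (f u w))|exact: d2].
Qed.

Lemma Cb_fun3_23 k (f : R -> R -> R) : Cb_fun2 k f ->
  Cb_fun3 k (fun p => f p.1.2 p.2).
Proof.
have [c1 c2 c3] := continuous_proj3.
elim: k f => [|k IH] f Cf; (split; [exact/cvg_pair_comp/c3/c2/(Cb_fun2_cont Cf)|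
  by have [B bf] := Cb_fun2_bounded Cf; exists B | ]) => //.
have [d1 d2 C1 C2] := Cb_fun2S Cf.
exists (fun=> 0), (fun p => pd1 f p.1.2 p.2), (fun p => pd2 f p.1.2 p.2).
split; last by split; [exact: Cb_fun3_cst|exact: IH|exact: IH].
by move=> u v w; split; [exact: (is_derive_cst (f v w))|exact: d1|exact: d2].
Qed.

Lemma tripletF_Cb_fun3 (Gamma : R -> R) (H : R -> R -> R) :
  Cb_fun1 2 Gamma -> Cb_fun2 3 H ->
  Cb_fun3 2 (fun p => tripletF Gamma H p.1.1 p.1.2 p.2).
Proof.
move=> CG CH; have [_ _ CH1 CH2] := Cb_fun2S CH; have {}CH := Cb_fun2W CH.
have Gvu : Cb_fun3 2 (fun p => Gamma (p.1.2 - p.1.1)).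
  rewrite (_ : (fun p => _) =
    fun p => Gamma ((-1) * p.1.1 + 1 * p.1.2 + 0 * p.2)); last first.
    by apply/funext => p; congr Gamma; lra.
  exact: Cb_fun3_linear.
have Gwu : Cb_fun3 2 (fun p => Gamma (p.2 - p.1.1)).
  rewrite (_ : (fun p => _) =
    fun p => Gamma ((-1) * p.1.1 + 0 * p.1.2 + 1 * p.2)); last first.
    by apply/funext => p; congr Gamma; lra.
  exact: Cb_fun3_linear.
have Gwv : Cb_fun3 2 (fun p => Gamma (p.2 - p.1.2)).
  rewrite (_ : (fun p => _) =
    fun p => Gamma (0 * p.1.1 + (-1) * p.1.2 + 1 * p.2)); last first.
    by apply/funext => p; congr Gamma; lra.
  exact: Cb_fun3_linear.
rewrite /tripletF; apply: Cb_fun3D; apply: Cb_fun3N.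
  apply: Cb_fun3M => //; apply: Cb_fun3M (Cb_fun3_13 CH).
  exact: Cb_fun3M Gvu (Cb_fun3_12 CH1).
apply: Cb_fun3M => //; apply: Cb_fun3M (Cb_fun3_23 CH).
exact: Cb_fun3M Gvu (Cb_fun3_12 CH2).
Qed.

End ThreeVariables.

(** * Mean value estimates, uniform on compact sets *)

Section UniformEstimates.
Context {R : realType}.

(** The mean value theorem for an increment of either sign, possibly zero. *)
Lemma mvt_increment (g dg : R -> R) (a s : R) :
  (forall t : R, is_derive t 1 g (dg t)) ->
  exists2 c, `|c - a| <= `|s| & g (a + s) - g a = s * dg c.
Proof.
move=> gd; have cg : continuous g.
  by move=> x; apply/differentiable_continuous/derivable1_diffP; case: (gd x).
have mvt x y : x <= y ->
    exists2 c, c \in `[x, y]%R & g y - g x = dg c * (y - x).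
  move=> xy; apply: MVT_segment => //; exact: continuous_subspaceT.
have [s0|/ltW s0] := leP 0 s.
  have [|c] := mvt a (a + s); first by rewrite lerDl.
  rewrite in_itv/= => /andP[ac cs] ->; exists c; last by rewrite addrC addKr mulrC.
  by rewrite !ger0_norm ?subr_ge0 // lerBlDl.
have [|c] := mvt (a + s) a; first by rewrite gerDl.
rewrite in_itv/= => /andP[ac cs] E; exists c.
  by rewrite !ler0_norm ?subr_le0 // lerN2 lerBrDl.
by rewrite -opprB E; lra.
Qed.

(** In the Heine-Cantor theorem the second point may leave the compact set: this
is the form needed for perturbations theta + h of a function theta with values in
the compact set. Compactness enters as the covering property along the filter of
radii tending to 0. *)
Lemma compact_uniform_continuity (T : pseudoMetricType R) (K : set T)
    (G : T -> R) : compact K -> continuous G -> forall e : R, 0 < e ->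
  exists2 d : R, 0 < d & forall p q, K p -> ball p d q -> `|G q - G p| < e.
Proof.
move=> /compact_near_coveringP cK cG e e0.
(* the property is indexed by the radius, which will tend to 0 *)
pose P (d : R) (p : T) := forall q, ball p d q -> `|G q - G p| < e.
have /= cov : \forall d \near 0^'+, K `<=` P d.
  apply: cK => x Kx.
  have /cvgrPdist_lt/(_ (e / 2)) := cG x; rewrite divr_gt0// => /(_ isT).
  rewrite -nbhs_ballE => -[r /= r0 xr].
  exists (ball x (r / 2), [set d | d < r / 2]) => /=.
    split; first by apply: nbhsx_ballx; rewrite divr_gt0.
    by apply: nbhs_right_lt; rewrite divr_gt0.
  case=> y d /= [xy dr] q yq.
  have : `|G x - G q| < e / 2.
    apply: xr; rewrite (splitr r); apply: ball_triangle xy _.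
    exact: (le_ball (ltW dr)).
  have : `|G x - G y| < e / 2.
    apply: xr; apply: le_ball xy; rewrite ler_pdivrMr//; lra.
  by rewrite !ltr_norml => /andP[? ?] /andP[? ?]; apply/andP; split; lra.
have [d [d0 Kd]] := filter_ex (filterI (nbhs_right_gt 0) cov).
by exists d => // p q Kp; exact: Kd.
Qed.

(** The increment of [G] is telescoped along the three coordinate axes; by the
mean value theorem each term is a partial derivative at a point close to
(u,v,w), and the partial derivatives are uniformly continuous near [K]. *)
Lemma partials_taylor (K : set (R * R * R)) (G G1 G2 G3 : R * R * R -> R) :
  compact K -> partials G G1 G2 G3 ->
  continuous G1 -> continuous G2 -> continuous G3 ->
  forall e : R, 0 < e -> exists2 d : R, 0 < d &
    forall u v w a b c, K (u, v, w) -> `|a| < d -> `|b| < d -> `|c| < d ->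
    `|G (u + a, v + b, w + c) - G (u, v, w) -
      (G1 (u, v, w) * a + G2 (u, v, w) * b + G3 (u, v, w) * c)|
      <= e * (`|a| + `|b| + `|c|).
Proof.
move=> cK dG c1 c2 c3 e e0.
have [d1 d10 h1] := compact_uniform_continuity cK c1 e0.
have [d2 d20 h2] := compact_uniform_continuity cK c2 e0.
have [d3 d30 h3] := compact_uniform_continuity cK c3 e0.
exists (Num.min d1 (Num.min d2 d3)); first by rewrite !lt_min d10 d20.
move=> u v w a b c Kp; rewrite !lt_min.
move=> /and3P[a1 a2 a3] /and3P[b1 b2 b3] /and3P[g1 g2 g3].
have [x xa E1] := @mvt_increment (fun t => G (t, v + b, w + c))
  (fun t => G1 (t, v + b, w + c)) u a
  (fun t => let: And3 h _ _ := dG t (v + b) (w + c) in h).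
have [y yb E2] := @mvt_increment (fun t => G (u, t, w + c))
  (fun t => G2 (u, t, w + c)) v b
  (fun t => let: And3 _ h _ := dG u t (w + c) in h).
have [z zc E3] := @mvt_increment (fun t => G (u, v, t)) (fun t => G3 (u, v, t)) w c
  (fun t => let: And3 _ _ h := dG u v t in h).
have ballP (d : R) x' y' z' : `|x' - u| < d -> `|y' - v| < d -> `|z' - w| < d ->
    ball (u, v, w) d (x', y', z').
  by move=> *; split; first split; rewrite /ball/= distrC.
have {}h1 : `|G1 (x, v + b, w + c) - G1 (u, v, w)| < e.
  by apply: h1 => //; apply: ballP;
    rewrite ?[_ + _ - _]addrAC ?subrr ?add0r // (le_lt_trans xa).
have {}h2 : `|G2 (u, y, w + c) - G2 (u, v, w)| < e.
  by apply: h2 => //; apply: ballP;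
    rewrite ?[_ + _ - _]addrAC ?subrr ?add0r ?normr0 // (le_lt_trans yb).
have {}h3 : `|G3 (u, v, z) - G3 (u, v, w)| < e.
  by apply: h3 => //; apply: ballP; rewrite ?subrr ?normr0 // (le_lt_trans zc).
rewrite (_ : _ - _ - _ = a * (G1 (x, v + b, w + c) - G1 (u, v, w)) +
  b * (G2 (u, y, w + c) - G2 (u, v, w)) + c * (G3 (u, v, z) - G3 (u, v, w))).
  have le_mul (r s : R) : `|s| < e -> `|r * s| <= e * `|r|.
    by move=> /ltW se; rewrite normrM mulrC ler_wpM2r.
  apply: (le_trans (ler_normD _ _)); rewrite (mulrDr e) lerD ?le_mul//.
  by apply: (le_trans (ler_normD _ _)); rewrite (mulrDr e) lerD ?le_mul.
by move: E1 E2 E3 => /= E1 E2 E3; lra.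
Qed.

(** The mean value theorem, applied first in the second variable to the
difference [U (v + s) - U v] and then in the first variable to [U2], writes the
mixed difference as [s * t] times a value of [U12] close to (v,w). The error
relative to [s * t] is what matters: the estimate is integrated against bumps. *)
Lemma mixed_difference (U U2 U12 : R -> R -> R) (v w : R) :
  (forall a b : R, is_derive b 1 (U a) (U2 a b)) ->
  (forall a b : R, is_derive a 1 (U2 ^~ b) (U12 a b)) ->
  {for (v, w), continuous (fun p : R * R => U12 p.1 p.2)} ->
  forall e : R, 0 < e -> exists2 d : R, 0 < d &
    forall s t : R, `|s| < d -> `|t| < d ->
    `|U (v + s) (w + t) - U (v + s) w - U v (w + t) + U v w - s * t * U12 v w|
      <= e * `|s * t|.
Proof.
move=> dU2 dU12 cU12 e e0.
have /cvgrPdist_lt/(_ e e0) := cU12.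
rewrite -nbhs_ballE => -[d /= d0 vwd]; exists d => // s t sd td.
have [y yt E1] := @mvt_increment (fun b => U (v + s) b - U v b)
   (fun b => U2 (v + s) b - U2 v b) w t (fun b => is_deriveB (dU2 _ _) (dU2 _ _)).
have [x xs E2] := @mvt_increment _ _ v s (fun a => dU12 a y).
have := vwd (x, y); rewrite /ball/= => /(_ _)/ltW h.
rewrite (_ : _ - _ = s * t * (U12 x y - U12 v w)); last first.
  by move: E1 E2 => /= E1 E2; move: E1; rewrite E2 => E1; lra.
rewrite normrM mulrC ler_wpM2r// distrC; apply: h.
by split; rewrite /ball/= distrC; apply: le_lt_trans; eassumption.
Qed.

End UniformEstimates.

(** * Averages over the unit interval of continuous functions *)

Section Averages.
Context {R : realType}.
Local Notation mu := (@lebesgue_measure R).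

Definition mean (phi : R -> R) : R := \int[mu]_(y in I01) phi y.

Lemma measurable_I01 : measurable (I01 : set (measurableTypeR R)).
Proof. exact: measurable_itv. Qed.

Lemma continuous_integrable01 (phi : R -> R) : continuous phi ->
  mu.-integrable I01 (EFin \o phi).
Proof.
move=> cphi; apply: continuous_compact_integrable; first exact: segment_compact.
exact: continuous_subspaceT.
Qed.

Lemma mean_cst (c : R) : mean (fun=> c) = c.
Proof.
rewrite /mean Rintegral_cst; last exact: measurable_I01.
by rewrite /= lebesgue_measure_itv/= lte_fin ltr01 sube0 /= mulr1.
Qed.

Lemma eq_mean (phi psi : R -> R) : (forall y, I01 y -> phi y = psi y) ->
  mean phi = mean psi.
Proof. by move=> E; apply: eq_Rintegral => y; rewrite inE; exact: E. Qed.

Lemma mean_linear (a : R) (phi psi : R -> R) : continuous phi ->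
  continuous psi -> mean (fun y => a * phi y + psi y) = a * mean phi + mean psi.
Proof.
move=> /continuous_integrable01 iphi /continuous_integrable01 ipsi.
have mI := measurable_I01.
rewrite /mean RintegralD//; first by rewrite RintegralZl.
by have := integrableZl mI a iphi; apply: eq_integrable.
Qed.

Lemma meanZ (r : R) (phi : R -> R) : continuous phi ->
  mean (fun y => r * phi y) = r * mean phi.
Proof.
move=> cphi.
by apply: RintegralZl; [exact: measurable_I01|exact: continuous_integrable01].
Qed.

Lemma le_norm_mean (phi psi : R -> R) : continuous phi -> continuous psi ->
  (forall y, I01 y -> `|phi y| <= psi y) -> `|mean phi| <= mean psi.
Proof.
move=> cphi cpsi le; have mI := measurable_I01.
have cn : continuous (fun y => `|phi y|).
  by move=> y; apply: cvg_norm; exact: cphi.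
apply: (le_trans (le_normr_Rintegral mI (continuous_integrable01 cphi))).
by apply: le_Rintegral => //; exact: continuous_integrable01.
Qed.

Lemma continuous_section (T : topologicalType) (Phi : T * R -> R) (t : T) :
  continuous Phi -> continuous (fun z => Phi (t, z)).
Proof.
move=> cPhi z; have ctz : {for z, continuous (fun z : R => (t, z))}.
  exact: (cvg_pair (cvg_cst t) cvg_id).
have := continuous_comp ctz (cPhi (t, z)); exact.
Qed.

(** By compactness of [0,1], for [t] close to [t0] the sections of [Phi] at [t]
and [t0] are uniformly close. *)
Lemma continuous_mean (T : topologicalType) (Phi : T * R -> R) :
  continuous Phi -> continuous (fun t => mean (fun z => Phi (t, z))).
Proof.
move=> cPhi t0; apply/cvgrPdist_le => e e0.
have /compact_near_coveringP cI : compact (I01 : set R) by exact: segment_compact.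
have /= cov : \forall t \near t0,
    I01 `<=` (fun z => `|Phi (t0, z) - Phi (t, z)| <= e).
  apply: cI => z Iz.
  have /cvgrPdist_lt/(_ (e / 2)) := cPhi (t0, z).
  rewrite divr_gt0// => /(_ isT) [[A B]] /= [At Bz] AB.
  exists (B, A) => // -[z' t] /= [Bz' At'].
  have : `|Phi (t0, z) - Phi (t, z')| < e / 2 by apply: (AB (t, z')).
  have : `|Phi (t0, z) - Phi (t0, z')| < e / 2.
    by apply: (AB (t0, z')); split=> //=; exact: nbhs_singleton.
  by rewrite !ltr_norml ler_norml => /andP[? ?] /andP[? ?]; apply/andP; split; lra.
apply: filterS cov => t tI.
rewrite (_ : _ - _ = mean (fun z => -1 * Phi (t, z) + Phi (t0, z))); last first.
  by rewrite mean_linear ?mulN1r; [rewrite addrC|exact: continuous_section..].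
rewrite -[leRHS]mean_cst; apply: le_norm_mean => //.
- move=> z; apply: cvgD; last exact: continuous_section.
  by apply: cvgM; [exact: cvg_cst|exact: continuous_section].
- by move=> z; exact: cvg_cst.
- by move=> z /tI; rewrite mulN1r addrC.
Qed.

Definition mean2 (Phi : R * R * R -> R) (x : R) : R :=
  mean (fun y => mean (fun z => Phi (x, y, z))).

Lemma continuous_mean2 Phi : continuous Phi -> continuous (mean2 Phi).
Proof.
move=> cPhi; have := continuous_mean (continuous_mean cPhi); exact.
Qed.

Lemma continuous_mean2_section (Phi : R * R * R -> R) (x : R) : continuous Phi ->
  continuous (fun y => mean (fun z => Phi (x, y, z))).
Proof. by move=> cPhi; exact: continuous_section (continuous_mean cPhi). Qed.

Lemma mean2_linear (a : R) (Phi Psi : R * R * R -> R) (x : R) :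
  continuous Phi -> continuous Psi ->
  mean2 (fun p => a * Phi p + Psi p) x = a * mean2 Phi x + mean2 Psi x.
Proof.
move=> cPhi cPsi; rewrite /mean2 -mean_linear; last 2 first.
- exact: continuous_mean2_section.
- exact: continuous_mean2_section.
by apply: eq_mean => y _; rewrite mean_linear//; exact: continuous_section.
Qed.

Lemma mean2D (Phi Psi : R * R * R -> R) (x : R) :
  continuous Phi -> continuous Psi ->
  mean2 (fun p => Phi p + Psi p) x = mean2 Phi x + mean2 Psi x.
Proof.
move=> cPhi cPsi; rewrite -[X in X + _]mul1r -(mean2_linear 1 x cPhi cPsi).
by congr (mean2 _ x); apply/funext => p; rewrite mul1r.
Qed.

Lemma mean2Z (a : R) (Phi : R * R * R -> R) (x : R) : continuous Phi ->
  mean2 (fun p => a * Phi p) x = a * mean2 Phi x.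
Proof.
move=> cPhi; rewrite /mean2 -meanZ; last exact: continuous_mean2_section.
by apply: eq_mean => y _; rewrite meanZ//; exact: continuous_section.
Qed.

Lemma mean2B (Phi Psi : R * R * R -> R) (x : R) :
  continuous Phi -> continuous Psi ->
  mean2 (fun p => Phi p - Psi p) x = mean2 Phi x - mean2 Psi x.
Proof.
move=> cPhi cPsi.
rewrite addrC -[X in X + _]mulN1r -(mean2_linear (-1) x cPsi cPhi).
by congr (mean2 _ x); apply/funext => p; rewrite mulN1r addrC.
Qed.

Lemma le_norm_mean2 (Phi Psi : R * R * R -> R) (x : R) :
  continuous Phi -> continuous Psi ->
  (forall y z, `|Phi (x, y, z)| <= Psi (x, y, z)) ->
  `|mean2 Phi x| <= mean2 Psi x.
Proof.
move=> cPhi cPsi le; apply: le_norm_mean; try exact: continuous_mean2_section.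
by move=> y _; apply: le_norm_mean => //; exact: continuous_section.
Qed.

Lemma le_norm_mean2_cst (Phi : R * R * R -> R) (x c : R) : continuous Phi ->
  (forall y z, `|Phi (x, y, z)| <= c) -> `|mean2 Phi x| <= c.
Proof.
move=> cPhi le; apply: le_trans (le_norm_mean2 (Psi := fun=> c) cPhi _ le) _.
  by move=> p; exact: cvg_cst.
by rewrite /mean2 !mean_cst.
Qed.

End Averages.

(** * Continuous functions on the unit interval and the supremum norm *)

Section SupNorm.
Context {R : realType}.
Implicit Types f g h : R -> R.

Definition clamp (t : R) : R := Num.max 0 (Num.min 1 t).

Lemma I01P (t : R) : I01 t <-> 0 <= t <= 1.
Proof. by rewrite /I01 /= in_itv. Qed.

Lemma clamp_I01 t : I01 (clamp t).
Proof. by apply/I01P; rewrite /clamp le_max lexx ge_max ler01 ge_min lexx. Qed.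

Lemma clamp_id t : I01 t -> clamp t = t.
Proof. by move=> /I01P/andP[t0 t1]; rewrite /clamp (min_idPr t1) (max_idPr t0). Qed.

Lemma continuous_clamp : continuous clamp.
Proof.
move=> t; apply: continuous_max; first exact: cvg_cst.
by apply: continuous_min; [exact: cvg_cst|exact: cvg_id].
Qed.

(** Only the values on [0,1] of a member of C([0,1]) are meaningful; composing
with the projection onto [0,1] gives a representative that is continuous and
bounded by the supremum norm on the whole line. *)
Definition ext f : R -> R := fun t => f (clamp t).

Lemma ext_id f t : I01 t -> ext f t = f t.
Proof. by rewrite /ext => /clamp_id ->. Qed.

Lemma continuous_ext f : C01 f -> continuous (ext f).
Proof.
move=> /subspace_continuousP cf t.
have ct : clamp @ t --> within I01 (nbhs (clamp t)).
  move=> A /=; rewrite /within/= => /continuous_clamp.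
  apply: (@filterS _ (nbhs t)) => s /=.
  by move=> sA; apply: sA; exact: clamp_I01.
have := @cvg_comp _ _ _ clamp f _ _ _ ct (cf _ (clamp_I01 t)); exact.
Qed.

Lemma continuous_C01 f : continuous f -> C01 f.
Proof. exact: continuous_subspaceT. Qed.

Lemma eq_C01 f g : continuous g -> (forall x, I01 x -> f x = g x) -> C01 f.
Proof.
move=> /continuous_C01 cg fg; apply: subspace_eq_continuous cg => x.
by rewrite inE => /fg.
Qed.

Lemma C01D f g : C01 f -> C01 g -> C01 (f \+ g).
Proof.
move=> /continuous_ext cf /continuous_ext cg.
apply: (@eq_C01 _ (ext f \+ ext g)); last by move=> x Ix; rewrite /= !ext_id.
by move=> x; apply: cvgD; [exact: cf|exact: cg].
Qed.

Lemma norm01_le f (c : R) : (forall x, I01 x -> `|f x| <= c) -> norm01 f <= c.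
Proof.
move=> fc; apply: ge_sup; last by move=> _ [x Ix <-]; exact: fc.
by exists `|f 0|, 0 => //; apply/I01P; lra.
Qed.

(** The supremum defining the norm is over a bounded set because a continuous
function attains its maximum on [0,1]. *)
Lemma le_norm01 f t : C01 f -> `|ext f t| <= norm01 f.
Proof.
move=> /continuous_ext cf; apply: ub_le_sup; last first.
  by exists (clamp t) => //; exact: clamp_I01.
have cn : {within `[0, 1], continuous (fun t => `|ext f t|)}.
  by apply: continuous_subspaceT => x; apply: cvg_norm; exact: cf.
have [c _ cmax] := EVT_max ler01 cn.
exists `|ext f c| => _ [x Ix <-]; rewrite -(ext_id f Ix); exact: cmax.
Qed.

Lemma norm01_ge0 f : C01 f -> 0 <= norm01 f.
Proof. by move=> Cf; exact: le_trans (le_norm01 0 Cf). Qed.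

Definition lift3 f (p : R * R * R) : R * R * R := (f p.1.1, f p.1.2, f p.2).

Lemma continuous_coords f : continuous f ->
  [/\ continuous (fun p : R * R * R => f p.1.1),
      continuous (fun p : R * R * R => f p.1.2)
    & continuous (fun p : R * R * R => f p.2)].
Proof.
have [c1 c2 c3] := @continuous_proj3 R.
move=> cf; split=> p; [have := continuous_comp (c1 p) (cf _)|
  have := continuous_comp (c2 p) (cf _)|have := continuous_comp (c3 p) (cf _)];
  exact.
Qed.

Lemma continuous_lift3 f : continuous f -> continuous (lift3 f).
Proof.
move=> /continuous_coords[c1 c2 c3] p.
exact: (cvg_pair (cvg_pair (c1 p) (c2 p)) (c3 p)).
Qed.

End SupNorm.

(** * Averaged operators are twice continuously differentiable *)

Section LinearOperators.
Context {R : realType}.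
Implicit Types (f g h : R -> R) (a b : R * R * R -> R) (p : R * R * R).

(** The differential of a function of three variables with partial derivatives
[a1], [a2], [a3], evaluated on the values of [g] at the three points; both the
first and the second derivative of the averaged operator are averages of such
expressions. *)
Definition lin3 a1 a2 a3 g p : R :=
  a1 p * ext g p.1.1 + a2 p * ext g p.1.2 + a3 p * ext g p.2.

Lemma continuous_lin3 a1 a2 a3 g : continuous a1 -> continuous a2 ->
  continuous a3 -> C01 g -> continuous (lin3 a1 a2 a3 g).
Proof.
move=> k1 k2 k3 /continuous_ext /continuous_coords[g1 g2 g3] p.
exact: cvgD (cvgD (cvgM (k1 p) (g1 p)) (cvgM (k2 p) (g2 p))) (cvgM (k3 p) (g3 p)).
Qed.

Lemma le_norm_lin3 a1 a2 a3 g p (c : R) : C01 g ->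
  `|a1 p| <= c -> `|a2 p| <= c -> `|a3 p| <= c ->
  `|lin3 a1 a2 a3 g p| <= 3 * c * norm01 g.
Proof.
move=> Cg le1 le2 le3; have gn t := le_norm01 t Cg.
have le (r s : R) : `|r| <= c -> `|ext g s| <= norm01 g ->
    `|r * ext g s| <= c * norm01 g.
  by move=> rc sc; rewrite normrM ler_pM.
rewrite (_ : 3 * c * _ = c * norm01 g + c * norm01 g + c * norm01 g); last by lra.
do 2 (apply: (le_trans (ler_normD _ _)); rewrite lerD ?le//).
Qed.

Definition linop a1 a2 a3 g : R -> R := mean2 (lin3 a1 a2 a3 g).

Lemma linop_bounded a1 a2 a3 (c : R) :
  continuous a1 -> continuous a2 -> continuous a3 ->
  (forall p, [/\ `|a1 p| <= c, `|a2 p| <= c & `|a3 p| <= c]) ->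
  forall g, C01 g -> norm01 (linop a1 a2 a3 g) <= 3 * c * norm01 g.
Proof.
move=> k1 k2 k3 ac g Cg; apply: norm01_le => x _.
apply: le_norm_mean2_cst; first exact: continuous_lin3.
by move=> y z; have [? ? ?] := ac (x, y, z); exact: le_norm_lin3.
Qed.

Lemma linop_linear a1 a2 a3 (r : R) f g x :
  continuous a1 -> continuous a2 -> continuous a3 -> C01 f -> C01 g ->
  linop a1 a2 a3 (fun t => r * f t + g t) x =
  r * linop a1 a2 a3 f x + linop a1 a2 a3 g x.
Proof.
move=> k1 k2 k3 Cf Cg; rewrite -mean2_linear; [|exact: continuous_lin3..].
by congr (mean2 _ x); apply/funext => p; rewrite /lin3/ext; lra.
Qed.

Lemma linop_bounded_linear01 a1 a2 a3 (c : R) :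
  continuous a1 -> continuous a2 -> continuous a3 ->
  (forall p, [/\ `|a1 p| <= c, `|a2 p| <= c & `|a3 p| <= c]) ->
  bounded_linear01 (linop a1 a2 a3).
Proof.
move=> k1 k2 k3 ac; split.
- by move=> g Cg; apply/continuous_C01/continuous_mean2/continuous_lin3.
- by move=> r f g Cf Cg x _; exact: linop_linear.
- by exists (3 * c); exact: linop_bounded.
Qed.

Lemma linop_coef_linear a1 a2 a3 b1 b2 b3 (r : R) g x :
  continuous a1 -> continuous a2 -> continuous a3 ->
  continuous b1 -> continuous b2 -> continuous b3 -> C01 g ->
  linop (fun p => r * a1 p + b1 p) (fun p => r * a2 p + b2 p)
        (fun p => r * a3 p + b3 p) g x =
  r * linop a1 a2 a3 g x + linop b1 b2 b3 g x.
Proof.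
move=> *; rewrite -mean2_linear; [|exact: continuous_lin3..].
by congr (mean2 _ x); apply/funext => p; rewrite /lin3; lra.
Qed.

Lemma linop_coefB a1 a2 a3 b1 b2 b3 g x :
  continuous a1 -> continuous a2 -> continuous a3 ->
  continuous b1 -> continuous b2 -> continuous b3 -> C01 g ->
  linop (fun p => a1 p - b1 p) (fun p => a2 p - b2 p) (fun p => a3 p - b3 p) g x =
  linop a1 a2 a3 g x - linop b1 b2 b3 g x.
Proof.
move=> *; rewrite -mean2B; [|exact: continuous_lin3..].
by congr (mean2 _ x); apply/funext => p; rewrite /lin3; lra.
Qed.

End LinearOperators.

Section FrechetDerivatives.
Context {R : realType}.
Implicit Types (f g h : R -> R) (G : R * R * R -> R).

(** The values of [G] at (f(x), f(y), f(z)), a continuous function of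
(x,y,z) on all of R^3. *)
Definition along G f : R * R * R -> R := G \o lift3 (ext f).

Lemma continuous_along G f : continuous G -> C01 f -> continuous (along G f).
Proof.
move=> cG /continuous_ext /continuous_lift3 cf p.
have := continuous_comp (cf p) (cG _); exact.
Qed.

(** This is where compactness comes from: a continuous function on [0,1] is
bounded, so all triples of its values lie in one box. *)
Lemma lift3_box f : C01 f ->
  exists2 K : set (R * R * R), compact K & forall p, K (lift3 (ext f) p).
Proof.
move=> Cf; pose J : set R := `[- norm01 f, norm01 f]%classic.
have cJ : compact J by exact: segment_compact.
exists ((J `*` J) `*` J); first by apply: compact_setX => //; exact: compact_setX.
have fJ t : J (ext f t) by rewrite /J/= in_itv/= -ler_norml le_norm01.
by move=> p; split; [split; exact: fJ|exact: fJ].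
Qed.

(** The differential of [G] along [f] in the direction [h]. *)
Definition increments G1 G2 G3 f h : R * R * R -> R :=
  lin3 (along G1 f) (along G2 f) (along G3 f) h.

Lemma continuous_increments G1 G2 G3 f h : continuous G1 -> continuous G2 ->
  continuous G3 -> C01 f -> C01 h -> continuous (increments G1 G2 G3 f h).
Proof. by move=> *; apply: continuous_lin3 => //; exact: continuous_along. Qed.

Lemma along_taylor G G1 G2 G3 f : partials G G1 G2 G3 ->
  continuous G1 -> continuous G2 -> continuous G3 -> C01 f ->
  forall e : R, 0 < e -> exists2 d : R, 0 < d &
    forall h, C01 h -> norm01 h < d -> forall p,
    `|along G (f \+ h) p - along G f p - increments G1 G2 G3 f h p|
      <= e * norm01 h.
Proof.
move=> dG k1 k2 k3 Cf e e0; have [K cK Kf] := lift3_box Cf.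
have e30 : 0 < e / 3 by rewrite divr_gt0.
have [d d0 H] := partials_taylor cK dG k1 k2 k3 e30.
exists d => // h Ch hd p; have hn t := le_norm01 t Ch.
have {}hd t : `|ext h t| < d by exact: le_lt_trans (hn t) hd.
apply: le_trans (H _ _ _ _ _ _ (Kf p) (hd p.1.1) (hd p.1.2) (hd p.2)) _.
rewrite [leRHS](_ : _ = e / 3 * (norm01 h + norm01 h + norm01 h)); last by lra.
by rewrite (ler_wpM2l (ltW e30))// !lerD.
Qed.

Lemma along_uniform G f : continuous G -> C01 f ->
  forall e : R, 0 < e -> exists2 d : R, 0 < d &
    forall h, C01 h -> norm01 h < d -> forall p,
    `|along G (f \+ h) p - along G f p| <= e.
Proof.
move=> cG Cf e e0; have [K cK Kf] := lift3_box Cf.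
have [d d0 H] := compact_uniform_continuity cK cG e0.
exists d => // h Ch hd p; apply/ltW/H => //.
have {}hd t : `|ext h t| < d by exact: le_lt_trans (le_norm01 t Ch) hd.
have E t : ext (f \+ h) t = ext f t + ext h t by [].
by split; [split|]; rewrite /ball/= E opprD addNKr normrN.
Qed.

Lemma increments_uniform G1 G2 G3 f : continuous G1 -> continuous G2 ->
  continuous G3 -> C01 f -> forall e : R, 0 < e -> exists2 d : R, 0 < d &
    forall h, C01 h -> norm01 h < d -> forall g, C01 g -> forall p,
    `|increments G1 G2 G3 (f \+ h) g p - increments G1 G2 G3 f g p|
      <= e * norm01 g.
Proof.
move=> k1 k2 k3 Cf e e0; have e30 : 0 < e / 3 by rewrite divr_gt0.
have [d1 d10 H1] := along_uniform k1 Cf e30.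
have [d2 d20 H2] := along_uniform k2 Cf e30.
have [d3 d30 H3] := along_uniform k3 Cf e30.
exists (Num.min d1 (Num.min d2 d3)); first by rewrite !lt_min d10 d20.
move=> h Ch; rewrite !lt_min => /and3P[hd1 hd2 hd3] g Cg p.
rewrite (_ : _ - _ = lin3 (fun p => along G1 (f \+ h) p - along G1 f p)
  (fun p => along G2 (f \+ h) p - along G2 f p)
  (fun p => along G3 (f \+ h) p - along G3 f p) g p); last first.
  by rewrite /increments/lin3; lra.
rewrite (_ : e * _ = 3 * (e / 3) * norm01 g); last by lra.
by apply: le_norm_lin3; [|exact: H1|exact: H2|exact: H3].
Qed.

Lemma le_norm_increments G1 G2 G3 (B : R) f h p : C01 h ->
  (forall q, `|G1 q| <= B) -> (forall q, `|G2 q| <= B) ->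
  (forall q, `|G3 q| <= B) ->
  `|increments G1 G2 G3 f h p| <= 3 * B * norm01 h.
Proof. by move=> Ch b1 b2 b3; apply: le_norm_lin3; [|exact: b1|exact: b2|exact: b3]. Qed.

Lemma increments_linear G1 G2 G3 f (r : R) g h :
  increments G1 G2 G3 f (fun t => r * g t + h t) =
  fun p => r * increments G1 G2 G3 f g p + increments G1 G2 G3 f h p.
Proof. by apply/funext => p; rewrite /increments/lin3/ext; ring. Qed.

Lemma Cb_fun3_common_bound k G1 G2 G3 :
  Cb_fun3 k G1 -> Cb_fun3 k G2 -> Cb_fun3 k G3 ->
  exists B : R, [/\ forall p, `|G1 p| <= B, forall p, `|G2 p| <= B
                  & forall p, `|G3 p| <= B].
Proof.
move=> /Cb_fun3_bounded[B1 b1] /Cb_fun3_bounded[B2 b2] /Cb_fun3_bounded[B3 b3].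
exists (Num.max B1 (Num.max B2 B3)).
by split=> p; rewrite !le_max ?b1 ?b2 ?b3 ?orbT.
Qed.

Lemma mean2_lift3_ext G f x : I01 x ->
  mean2 (G \o lift3 f) x = mean2 (along G f) x.
Proof.
move=> Ix; apply: eq_mean => y Iy; apply: eq_mean => z Iz.
by rewrite /along/lift3/= !ext_id.
Qed.

(** The derivatives are [DV f h], the average of the differential of [G] along
[f] in the direction [h], and [D2V f h g], the average of the differential whose
coefficients are the differentials of [G1], [G2], [G3] in the direction [h]. Since
[linop] is linear in its coefficients, each Frechet remainder is again an
average, of an integrand bounded pointwise by [along_taylor] or
[increments_uniform]. *)
Lemma mean2_lift3_C2 G : Cb_fun3 2 G ->
  C2_map01 (fun f => mean2 (G \o lift3 f)).
Proof.
move=> CG; have cG := Cb_fun3_cont CG.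
have [G1 [G2 [G3 [dG C1 C2 C3]]]] := Cb_fun3_partials CG.
have [k1 k2 k3] := And3 (Cb_fun3_cont C1) (Cb_fun3_cont C2) (Cb_fun3_cont C3).
have [B [b1 b2 b3]] := Cb_fun3_common_bound C1 C2 C3.
have [G11 [G12 [G13 [dG1 C11 C12 C13]]]] := Cb_fun3_partials C1.
have [G21 [G22 [G23 [dG2 C21 C22 C23]]]] := Cb_fun3_partials C2.
have [G31 [G32 [G33 [dG3 C31 C32 C33]]]] := Cb_fun3_partials C3.
have [B1 [b11 b12 b13]] := Cb_fun3_common_bound C11 C12 C13.
have [B2 [b21 b22 b23]] := Cb_fun3_common_bound C21 C22 C23.
have [B3 [b31 b32 b33]] := Cb_fun3_common_bound C31 C32 C33.
move: C11 C12 C13 => /Cb_fun3_cont k11 /Cb_fun3_cont k12 /Cb_fun3_cont k13.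
move: C21 C22 C23 => /Cb_fun3_cont k21 /Cb_fun3_cont k22 /Cb_fun3_cont k23.
move: C31 C32 C33 => /Cb_fun3_cont k31 /Cb_fun3_cont k32 /Cb_fun3_cont k33.
pose DV f := linop (along G1 f) (along G2 f) (along G3 f).
pose D2V f h := linop (increments G11 G12 G13 f h) (increments G21 G22 G23 f h)
  (increments G31 G32 G33 f h).
have cI1 f h := @continuous_increments _ _ _ f h k11 k12 k13.
have cI2 f h := @continuous_increments _ _ _ f h k21 k22 k23.
have cI3 f h := @continuous_increments _ _ _ f h k31 k32 k33.
pose S := Num.max B1 (Num.max B2 B3).
have D2V_bound f h p : C01 h ->
    [/\ `|increments G11 G12 G13 f h p| <= 3 * S * norm01 h,
        `|increments G21 G22 G23 f h p| <= 3 * S * norm01 h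
      & `|increments G31 G32 G33 f h p| <= 3 * S * norm01 h].
  move=> Ch; have leS (B0 : R) : B0 <= S -> 3 * B0 * norm01 h <= 3 * S * norm01 h.
    by move=> BS; rewrite ler_wpM2r ?norm01_ge0// ler_wpM2l.
  split; [apply: le_trans (leS B1 _)|apply: le_trans (leS B2 _)|
    apply: le_trans (leS B3 _)]; rewrite ?le_max ?lexx ?orbT//;
    exact: le_norm_increments.
have cB (a b : R * R * R -> R) : continuous a -> continuous b ->
    continuous (fun p => a p - b p).
  by move=> ca cb p; exact: cvgB (ca p) (cb p).
split.
  move=> f Cf; apply: (@eq_C01 _ _ (mean2 (along G f))).
    exact/continuous_mean2/continuous_along.
  by move=> x Ix; rewrite mean2_lift3_ext.
exists DV, D2V; split.
- move=> f Cf; apply: (@linop_bounded_linear01 _ _ _ _ B); try exact: continuous_along.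
  by move=> p; split; [exact: b1|exact: b2|exact: b3].
- move=> f Cf.
  have D2V_le h g : C01 h -> C01 g ->
      norm01 (D2V f h g) <= 3 * (3 * S * norm01 h) * norm01 g.
    move=> Ch Cg; apply: linop_bounded => //; [exact: cI1|exact: cI2|exact: cI3|].
    by move=> p; exact: D2V_bound.
  split.
  + move=> h Ch; apply: linop_bounded_linear01; [exact: cI1|exact: cI2|exact: cI3|].
    by move=> p; exact: D2V_bound.
  + move=> g Cg; split.
    * move=> h Ch; apply/continuous_C01/continuous_mean2/continuous_lin3 => //;
        [exact: cI1|exact: cI2|exact: cI3].
    * move=> r h1 h2 Ch1 Ch2 x _; rewrite /D2V !increments_linear;
        apply: linop_coef_linear;
        [exact: cI1|exact: cI2|exact: cI3|exact: cI1|exact: cI2|exact: cI3|by []].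
    * exists (3 * (3 * S) * norm01 g) => h Ch; apply: le_trans (D2V_le h g Ch Cg) _.
      by rewrite le_eqVlt; apply/orP; left; apply/eqP; lra.
  exists (3 * (3 * S)) => h g Ch Cg; apply: le_trans (D2V_le h g Ch Cg) _.
  by rewrite !mulrA.
- move=> f Cf e e0; have [d d0 T] := along_taylor dG k1 k2 k3 Cf e0.
  exists d => // h Ch hd; apply: norm01_le => x Ix.
  have Cfh := C01D Cf Ch.
  have cD := continuous_increments k1 k2 k3 Cf Ch.
  have cGf := continuous_along cG Cf; have cGfh := continuous_along cG Cfh.
  rewrite (mean2_lift3_ext G (f \+ h) Ix) (mean2_lift3_ext G f Ix).
  have cDD := cB _ _ cGfh cGf.
  rewrite -(mean2B x cGfh cGf) -(mean2B x cDD cD).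
  by apply: le_norm_mean2_cst => [|y z]; [exact: cB cDD cD|exact: T].
- move=> f Cf e e0; have e30 : 0 < e / 3 by rewrite divr_gt0.
  have [d1 d10 T1] := along_taylor dG1 k11 k12 k13 Cf e30.
  have [d2 d20 T2] := along_taylor dG2 k21 k22 k23 Cf e30.
  have [d3 d30 T3] := along_taylor dG3 k31 k32 k33 Cf e30.
  exists (Num.min d1 (Num.min d2 d3)); first by rewrite !lt_min d10 d20.
  move=> h Ch; rewrite !lt_min => /and3P[hd1 hd2 hd3] g Cg.
  have Cfh := C01D Cf Ch.
  have [l1 l2 l3] := And3 (continuous_along k1 Cf) (continuous_along k2 Cf)
    (continuous_along k3 Cf).
  have [m1 m2 m3] := And3 (continuous_along k1 Cfh) (continuous_along k2 Cfh)
    (continuous_along k3 Cfh).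
  have [i1 i2 i3] := And3 (cI1 _ _ Cf Ch) (cI2 _ _ Cf Ch) (cI3 _ _ Cf Ch).
  have [n1 n2 n3] := And3 (cB _ _ m1 l1) (cB _ _ m2 l2) (cB _ _ m3 l3).
  under eq_fun => x do rewrite -(linop_coefB x m1 m2 m3 l1 l2 l3 Cg)
    -(linop_coefB x n1 n2 n3 i1 i2 i3 Cg).
  rewrite (_ : e * _ = 3 * (e / 3 * norm01 h)); last by lra.
  apply: linop_bounded => //; [exact: cB|exact: cB|exact: cB|].
  by move=> p; split; [exact: T1|exact: T2|exact: T3].
- move=> f Cf e e0; have e30 : 0 < e / 3 by rewrite divr_gt0.
  have [d1 d10 T1] := increments_uniform k11 k12 k13 Cf e30.
  have [d2 d20 T2] := increments_uniform k21 k22 k23 Cf e30.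
  have [d3 d30 T3] := increments_uniform k31 k32 k33 Cf e30.
  exists (Num.min d1 (Num.min d2 d3)); first by rewrite !lt_min d10 d20.
  move=> h Ch; rewrite !lt_min => /and3P[hd1 hd2 hd3] g1 g2 Cg1 Cg2.
  have Cfh := C01D Cf Ch.
  have [i1 i2 i3] := And3 (cI1 _ _ Cf Cg1) (cI2 _ _ Cf Cg1) (cI3 _ _ Cf Cg1).
  have [j1 j2 j3] := And3 (cI1 _ _ Cfh Cg1) (cI2 _ _ Cfh Cg1) (cI3 _ _ Cfh Cg1).
  under eq_fun => x do rewrite -(linop_coefB x j1 j2 j3 i1 i2 i3 Cg2).
  rewrite (_ : e * _ = 3 * (e / 3 * norm01 g1)); last by lra.
  apply: linop_bounded => //; [exact: cB|exact: cB|exact: cB|].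
  by move=> p; split; [exact: T1|exact: T2|exact: T3].
Qed.

End FrechetDerivatives.

(** * Mixed second differences *)

Section SecondDifference.
Context {R : realType}.
Local Notation mu := (@lebesgue_measure R).

(** A bump of height 1 supported in the interval of radius 1/10 around [c]. *)
Definition tent (c t : R) : R := clamp (1 - 10 * `|t - c|).

Lemma clamp_ge0 (t : R) : 0 <= clamp t.
Proof. by have /I01P/andP[] := clamp_I01 t. Qed.

Lemma clamp_le1 (t : R) : clamp t <= 1.
Proof. by have /I01P/andP[] := clamp_I01 t. Qed.

Lemma clamp_eq0 (t : R) : t <= 0 -> clamp t = 0.
Proof.
by move=> t0; rewrite /clamp (min_idPr _) ?(max_idPl _)// (le_trans t0).
Qed.

Lemma clamp_eq1 (t : R) : 1 <= t -> clamp t = 1.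
Proof. by move=> t1; rewrite /clamp (min_idPl _)// (max_idPr _). Qed.

Lemma continuous_tent (c : R) : continuous (tent c).
Proof.
move=> t; have ct : {for t, continuous (fun t : R => 1 - 10 * `|t - c|)}.
  apply: cvgB; first exact: cvg_cst.
  apply: cvgM; first exact: cvg_cst.
  by apply: cvg_norm; apply: cvgB; [exact: cvg_id|exact: cvg_cst].
have := continuous_comp ct (@continuous_clamp R (1 - 10 * `|t - c|)); exact.
Qed.

Lemma tent_eq0 (c t : R) : 1 / 10 <= `|t - c| -> tent c t = 0.
Proof. by move=> ?; apply: clamp_eq0; lra. Qed.

Lemma mean_gt0 (phi : R -> R) (a b : R) (r : R) : continuous phi ->
  (forall y, 0 <= phi y) -> 0 <= a -> a < b -> b <= 1 -> 0 < r ->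
  (forall y, a <= y <= b -> r <= phi y) -> 0 < mean phi.
Proof.
move=> cphi phi0 a0 ab b1 r0 phir.
have mI := @measurable_I01 R.
have mab : measurable (`[a, b]%classic : set (measurableTypeR R)).
  exact: measurable_itv.
have /integrableP[mphi _] := continuous_integrable01 cphi.
have abI : `[a, b]%classic `<=` (I01 : set R).
  by move=> y; rewrite /= in_itv/= => /andP[? ?]; apply/I01P; lra.
have fin := integrable_fin_num mI (continuous_integrable01 cphi).
rewrite /mean /Rintegral -lte_fin fineK//.
apply: (@lt_le_trans _ _ (\int[mu]_(y in `[a, b]) r%:E)%E).
  rewrite integral_cst//= lebesgue_measure_itv/= lte_fin ab -EFinD -EFinM lte_fin.
  by rewrite mulr_gt0// subr_gt0.
apply: (@le_trans _ _ (\int[mu]_(y in `[a, b]) (phi y)%:E)%E).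
  apply: ge0_le_integral => //.
  - by move=> y _; rewrite lee_fin ltW.
  - exact: measurable_funS mphi.
by apply: ge0_subset_integral => // y _; rewrite lee_fin.
Qed.

Lemma mean_tent_gt0 (c : R) : 1 / 10 <= c <= 9 / 10 -> 0 < mean (tent c).
Proof.
move=> cI; apply: (@mean_gt0 _ (c - 1 / 20) (c + 1 / 20) (1 / 2)); try lra.
- exact: continuous_tent.
- by move=> y; exact: clamp_ge0.
- move=> y yc; have : `|y - c| <= 1 / 20 by rewrite ler_norml; lra.
  move=> yc'; rewrite /tent clamp_id; first lra.
  by apply/I01P; have := normr_ge0 (y - c); lra.
Qed.

Lemma mean2_product (phi psi : R -> R) (x : R) : continuous phi ->
  continuous psi ->
  mean2 (fun p => phi p.1.2 * psi p.2) x = mean phi * mean psi.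
Proof.
move=> cphi cpsi; rewrite /mean2/= mulrC -meanZ//.
by apply: eq_mean => y _; rewrite meanZ// mulrC.
Qed.

(** At every point at most one of the two bumps is active, and where a bump is
active [base] has a known value. The terms with [y] and [z] under the same bump
cancel; what is left are the mixed differences of [U] at (v,w) and at (w,v),
which vanish when one of the increments does. *)
Lemma second_difference_split (U : R -> R -> R) (base h k : R -> R) (v w : R) :
  (forall y, [\/ h y = 0 /\ k y = 0, base y = v /\ k y = 0 |
                 base y = w /\ h y = 0]) ->
  forall y z,
  U (base y + h y + k y) (base z + h z + k z) - U (base y + h y) (base z + h z)
  - U (base y + k y) (base z + k z) + U (base y) (base z) =
  (U (v + h y) (w + k z) - U (v + h y) w - U v (w + k z) + U v w) +
  (U (w + k y) (v + h z) - U (w + k y) v - U w (v + h z) + U w v).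
Proof.
move=> alt y z; case: (alt y) => -[-> ->]; case: (alt z) => -[-> ->];
  rewrite !addr0; lra.
Qed.

Definition mean_pair (U : R -> R -> R) (f : R -> R) : R :=
  mean (fun y => mean (fun z => U (f y) (f z))).

(** Only the sum of [U12 v w] and [U12 w v] is known to be nonzero, and each may
have either sign; so the two mixed differences of [second_difference_split] are
integrated separately, with errors relative to the product of the bumps, before
they are added. *)
Lemma mean_pair_second_difference (U U12 : R -> R -> R) (base h k : R -> R)
    (v w e : R) :
  continuous (fun p : R * R => U p.1 p.2) ->
  continuous base -> continuous h -> continuous k ->
  (forall y, 0 <= h y) -> (forall y, 0 <= k y) ->
  (forall y, [\/ h y = 0 /\ k y = 0, base y = v /\ k y = 0 |
                 base y = w /\ h y = 0]) ->
  (forall y z,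
    `|U (v + h y) (w + k z) - U (v + h y) w - U v (w + k z) + U v w
      - h y * k z * U12 v w| <= e * `|h y * k z|) ->
  (forall y z,
    `|U (w + k y) (v + h z) - U (w + k y) v - U w (v + h z) + U w v
      - k y * h z * U12 w v| <= e * `|k y * h z|) ->
  `|mean_pair U (fun y => base y + h y + k y)
    - mean_pair U (fun y => base y + h y)
    - mean_pair U (fun y => base y + k y) + mean_pair U base
    - (U12 v w + U12 w v) * (mean h * mean k)| <= 2 * e * (mean h * mean k).
Proof.
move=> cU cb ch ck h0 k0 alt Dhk Dkh.
pose Phi f (p : R * R * R) := U (f p.1.2) (f p.2).
have TE f : mean_pair U f = mean2 (Phi f) 0 by [].
have cPhi f : continuous f -> continuous (Phi f).
  by move=> /continuous_coords[_ c2 c3]; exact: cvg_pair_comp.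
have cbh : continuous (fun y => base y + h y) by move=> y; exact: cvgD (cb y) (ch y).
have cbk : continuous (fun y => base y + k y) by move=> y; exact: cvgD (cb y) (ck y).
have cbhk : continuous (fun y => base y + h y + k y).
  by move=> y; exact: cvgD (cbh y) (ck y).
have [_ h2 h3] := continuous_coords ch; have [_ k2 k3] := continuous_coords ck.
have chk : continuous (fun p : R * R * R => h p.1.2 * k p.2).
  by move=> p; exact: cvgM (h2 p) (k3 p).
have ckh : continuous (fun p : R * R * R => k p.1.2 * h p.2).
  by move=> p; exact: cvgM (k2 p) (h3 p).
have cZ (r : R) (Psi : R * R * R -> R) : continuous Psi ->
    continuous (fun p => r * Psi p).
  by move=> cPsi p; exact: cvgM (cvg_cst _) (cPsi p).
have cB (Psi Psi' : R * R * R -> R) : continuous Psi -> continuous Psi' ->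
    continuous (fun p => Psi p - Psi' p).
  by move=> c c' p; exact: cvgB (c p) (c' p).
have cD (Psi Psi' : R * R * R -> R) : continuous Psi -> continuous Psi' ->
    continuous (fun p => Psi p + Psi' p).
  by move=> c c' p; exact: cvgD (c p) (c' p).
have W (r s : R) : mean2 (fun p => r * (h p.1.2 * k p.2) + s * (k p.1.2 * h p.2)) 0
    = (r + s) * (mean h * mean k).
  rewrite (mean2D 0 (cZ r _ chk) (cZ s _ ckh)) (mean2Z r 0 chk) (mean2Z s 0 ckh).
  by rewrite !mean2_product//; lra.
have cW (r s : R) : continuous (fun p : R * R * R =>
    r * (h p.1.2 * k p.2) + s * (k p.1.2 * h p.2)).
  exact: cD _ _ (cZ r _ chk) (cZ s _ ckh).
have [c11 c10 c01] := And3 (cPhi _ cbhk) (cPhi _ cbh) (cPhi _ cbk).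
have c00 := cPhi _ cb.
have cE1 := cB _ _ c11 c10; have cE2 := cB _ _ cE1 c01; have cE3 := cD _ _ cE2 c00.
rewrite !TE -(mean2B 0 c11 c10) -(mean2B 0 cE1 c01) -(mean2D 0 cE2 c00).
rewrite -(W (U12 v w) (U12 w v)) -(mean2B 0 cE3 (cW _ _)).
rewrite (_ : 2 * e = e + e); last by lra.
rewrite -(W e e).
apply: le_norm_mean2; [exact: cB cE3 (cW _ _)|exact: cW|] => y z.
have split := second_difference_split U alt y z.
rewrite -[h y * k z in leRHS](ger0_norm (mulr_ge0 (h0 y) (k0 z))).
rewrite -[k y * h z in leRHS](ger0_norm (mulr_ge0 (k0 y) (h0 z))).
apply: le_trans (lerD (Dhk y z) (Dkh y z)); apply: le_trans _ (ler_normD _ _).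
rewrite le_eqVlt; apply/orP; left; apply/eqP; congr `| _ |.
by move: split; rewrite /Phi /= => ->; lra.
Qed.

(** The functions [f i j] are [base], with the first bump added when [i] holds
and the second one when [j] holds. *)
Lemma second_difference_probes (G : R * R * R -> R) (U2 U12 : R -> R -> R)
    (u v w : R) : continuous G ->
  (forall a b : R, is_derive b 1 (fun t => G (u, a, t)) (U2 a b)) ->
  (forall a b : R, is_derive a 1 (U2 ^~ b) (U12 a b)) ->
  continuous (fun p : R * R => U12 p.1 p.2) -> U12 v w + U12 w v <> 0 ->
  exists f : bool -> bool -> R -> R,
  [/\ forall i j, continuous (f i j),
      forall i j, exists B : R, forall y, `|f i j y| <= B,
      forall i j x, x <= 1 / 5 -> f i j x = u,
      forall y, f true true y = f true false y /\ f false true y = f false false y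
        \/ f true true y = f false true y /\ f true false y = f false false y
    & forall x, x <= 1 / 5 ->
      mean2 (G \o lift3 (f true true)) x - mean2 (G \o lift3 (f true false)) x
      - mean2 (G \o lift3 (f false true)) x
      + mean2 (G \o lift3 (f false false)) x <> 0].
Proof.
move=> cG dU2 dU12 cU12 M0; pose U a b := G (u, a, b).
set M := U12 v w + U12 w v in M0.
have e0 : 0 < `|M| / 4 by rewrite divr_gt0// normr_gt0; exact/eqP.
have [d1 d10 D1] := @mixed_difference _ U _ _ v w dU2 dU12 (cU12 (v, w)) _ e0.
have [d2 d20 D2] := @mixed_difference _ U _ _ w v dU2 dU12 (cU12 (w, v)) _ e0.
(* s is the height of the bumps: both mixed differences must be controlled *)
pose s := Num.min d1 d2 / 2.
have d0 : 0 < Num.min d1 d2 by rewrite lt_min d10.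
have s0 : 0 < s by rewrite divr_gt0.
have sd : s < Num.min d1 d2 by rewrite /s; lra.
(* base is u up to 1/5, v between 2/5 and 3/5 and w from 4/5 on, affine in
   between; each clamp is one of the two ramps *)
pose base y := u + (v - u) * clamp (5 * y - 1) + (w - v) * clamp (5 * y - 3).
pose h y := s * tent (1 / 2) y; pose k y := s * tent (9 / 10) y.
have cclamp (a : R) : continuous (fun y : R => clamp (5 * y - a)).
  move=> y; have cy : {for y, continuous (fun y : R => 5 * y - a)}.
    by apply: cvgB; [apply: cvgM; [exact: cvg_cst|exact: cvg_id]|exact: cvg_cst].
  have := continuous_comp cy (@continuous_clamp R (5 * y - a)); exact.
have cbase : continuous base.
  move=> y; apply: cvgD; first apply: cvgD; first exact: cvg_cst.
    by apply: cvgM; [exact: cvg_cst|exact: cclamp].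
  by apply: cvgM; [exact: cvg_cst|exact: cclamp].
have ch : continuous h.
  by move=> y; apply: cvgM; [exact: cvg_cst|exact: continuous_tent].
have ck : continuous k.
  by move=> y; apply: cvgM; [exact: cvg_cst|exact: continuous_tent].
have tent01 c y : 0 <= tent c y <= 1 by rewrite clamp_ge0 clamp_le1.
have stent c y : 0 <= s * tent c y < Num.min d1 d2.
  have /andP[t0 t1] := tent01 c y; rewrite mulr_ge0 ?(ltW s0)//=.
  by apply: le_lt_trans sd; rewrite ler_piMr ?(ltW s0).
have h0 y : 0 <= h y by have /andP[] := stent (1 / 2) y.
have k0 y : 0 <= k y by have /andP[] := stent (9 / 10) y.
have hd y : `|h y| < Num.min d1 d2.
  by rewrite ger0_norm//; have /andP[] := stent (1 / 2) y.
have kd y : `|k y| < Num.min d1 d2.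
  by rewrite ger0_norm//; have /andP[] := stent (9 / 10) y.
have alt y : [\/ h y = 0 /\ k y = 0, base y = v /\ k y = 0 |
                 base y = w /\ h y = 0].
  have far c : 1 / 10 <= `|y - c| -> s * tent c y = 0.
    by move=> /tent_eq0 ->; rewrite mulr0.
  have [y1|y1] := leP y (2 / 5).
    constructor 1; split; apply: far.
      by rewrite ler0_norm; lra.
    by rewrite ler0_norm; lra.
  have [y2|y2] := leP (4 / 5) y.
    constructor 3; split.
      by rewrite /base !clamp_eq1; lra.
    by apply: far; rewrite ger0_norm; lra.
  have [y3|y3] := leP y (3 / 5).
    constructor 2; split.
      by rewrite /base clamp_eq1 ?clamp_eq0; lra.
    by apply: far; rewrite ler0_norm; lra.
  constructor 1; split; apply: far.
    by rewrite ger0_norm; lra.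
  by rewrite ler0_norm; lra.
have mean_bump (c : R) : 1 / 10 <= c <= 9 / 10 -> 0 < mean (fun y => s * tent c y).
  move=> /mean_tent_gt0 c0; rewrite (meanZ s (@continuous_tent c)).
  exact: mulr_gt0.
have hk_gt0 : 0 < mean h * mean k.
  by apply: mulr_gt0; apply: mean_bump; lra.
pose f (i j : bool) y := base y + (if i then h y else 0) + (if j then k y else 0).
have f11 : f true true = fun y => base y + h y + k y by [].
have f10 : f true false = fun y => base y + h y by apply/funext => y; rewrite /f addr0.
have f01 : f false true = fun y => base y + k y by apply/funext => y; rewrite /f addr0.
have f00 : f false false = base by apply/funext => y; rewrite /f !addr0.
have fu i j x : x <= 1 / 5 -> f i j x = u.
  move=> x5; have hx : h x = 0 by rewrite /h tent_eq0 ?mulr0// ler0_norm; lra.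
  have kx : k x = 0 by rewrite /k tent_eq0 ?mulr0// ler0_norm; lra.
  rewrite /f hx kx !if_same /base (clamp_eq0 (t := 5 * x - 1)) ?clamp_eq0; lra.
exists f; split => //.
- move=> i j; have cif (b : bool) (g : R -> R) : continuous g ->
      continuous (fun y => if b then g y else 0).
    by case: b => // _ y; exact: cvg_cst.
  by move=> y; exact: cvgD (cvgD (cbase y) (cif i h ch y)) (cif j k ck y).
- move=> i j; exists (`|u| + `|v - u| + `|w - v| + s + s) => y.
  have le_s (b : bool) c : `|if b then s * tent c y else 0| <= s.
    case: b; last by rewrite normr0 ltW.
    have /andP[t0 t1] := tent01 c y.
    by rewrite (ger0_norm (mulr_ge0 (ltW s0) t0)); exact: (ler_piMr (ltW s0) t1).
  have le_clamp (a t : R) : `|a * clamp t| <= `|a|.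
    by rewrite normrM (ger0_norm (clamp_ge0 t)) ler_piMr// clamp_le1.
  apply: le_trans (ler_normD _ _) _; apply: lerD; last exact: le_s.
  apply: le_trans (ler_normD _ _) _; apply: lerD; last exact: le_s.
  apply: le_trans (ler_normD _ _) _; apply: lerD; last exact: le_clamp.
  by apply: le_trans (ler_normD _ _) _; apply: lerD.
- move=> y; rewrite f11 f10 f01 f00; case: (alt y) => -[E1 E2].
  + by left; rewrite E1 E2 !addr0.
  + by left; rewrite E2 !addr0.
  + by right; rewrite E2 !addr0.
move=> x x5; have TE i j : mean2 (G \o lift3 (f i j)) x = mean_pair U (f i j).
  by apply: eq_mean => y _; apply: eq_mean => z _; rewrite /= /lift3/= fu.
rewrite !TE f11 f10 f01 f00 => Delta0.
have cU : continuous (fun p : R * R => U p.1 p.2).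
  move=> p; have cp : {for p, continuous (fun p : R * R => (u, p.1, p.2))}.
    exact: (cvg_pair (cvg_pair (cvg_cst u) cvg_fst) cvg_snd).
  have := continuous_comp cp (cG (u, p.1, p.2)); exact.
have hk y : [/\ `|h y| < d1, `|h y| < d2, `|k y| < d1 & `|k y| < d2].
  by have := hd y; have := kd y; rewrite !lt_min => /andP[-> ->] /andP[-> ->].
have := @mean_pair_second_difference U U12 base h k v w (`|M| / 4) cU cbase ch ck
  h0 k0 alt.
rewrite Delta0 sub0r normrN -/M => bound {Delta0}; have {bound} :
    `|M * (mean h * mean k)| <= 2 * (`|M| / 4) * (mean h * mean k).
  apply: bound => y z; have [hy1 hy2 ky1 ky2] := hk y; have [hz1 hz2 kz1 kz2] := hk z.
    exact: D1.
  exact: D2.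
have M_gt0 : 0 < `|M| by rewrite normr_gt0; exact/eqP.
rewrite normrM (gtr0_norm hk_gt0) ler_pM2r//; lra.
Qed.

(** For each [y] the integrand cancels identically, because one of the two bumps
is zero there. *)
Lemma pairwise_second_difference (kappa : R -> R -> R -> R -> R)
    (f : bool -> bool -> R -> R) (x u : R) :
  (forall i j, f i j x = u) ->
  (forall y, f true true y = f true false y /\ f false true y = f false false y
        \/ f true true y = f false true y /\ f true false y = f false false y) ->
  (forall i j, pairwise_integrable kappa (f i j) x) ->
  pairwise_op kappa (f true true) x - pairwise_op kappa (f true false) x
  - pairwise_op kappa (f false true) x + pairwise_op kappa (f false false) x = 0.
Proof.
move=> fu alt int; have mI := @measurable_I01 R.
have intE i j : mu.-integrable I01 (EFin \o (fun y => kappa (f i j x) (f i j y) x y)).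
  exact: int.
have E : pairwise_op kappa (f true true) x - pairwise_op kappa (f true false) x =
    pairwise_op kappa (f false true) x - pairwise_op kappa (f false false) x.
  rewrite /pairwise_op -!RintegralB//; apply: eq_Rintegral => y _.
  by rewrite !fu; case: (alt y) => -[-> ->]; rewrite ?subrr.
by rewrite E addrAC subrK subrr.
Qed.

End SecondDifference.

(** * Averaged operators on essentially bounded functions *)

Section EssentiallyBounded.
Context {R : realType}.
Local Notation mu := (@lebesgue_measure R).
Local Notation mR := (measurableTypeR R).
Implicit Types f g : mR -> mR.

(** An open set is the union of the boxes with rational centre and radius that
it contains. *)
Lemma open_measurable3 (O : set (R * R * R)) : open O ->
  measurable (O : set (mR * mR * mR)).
Proof.
move=> oO.
pose box (q : rat * rat * rat * rat) : set (R * R * R) :=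
  (ball (ratr q.1.1.1 : R) (ratr q.2) `*` ball (ratr q.1.1.2 : R) (ratr q.2)) `*`
  ball (ratr q.1.2 : R) (ratr q.2).
have mbox q : measurable (box q : set (mR * mR * mR)).
  have mball (c r : R) : measurable (ball c r : set mR).
    by apply: open_measurable; exact: ball_open.
  by do 2 apply: measurableX => //.
(* boxes not contained in O are replaced by the empty set, so that the union
   runs over a countable type *)
have -> : O = \bigcup_q (if `[< box q `<=` O >] then box q else set0).
  apply/seteqP; split; last by move=> p [q _]; case: asboolP => // qO /qO.
  move=> [[x y] z] Op; have /nbhs_ballP[e /= e0 pO] : nbhs (x, y, z) O.
    exact: open_nbhs_nbhs.
  have [r] : exists r : rat, ratr r \in `]0, e / 2[%R.
    by apply: rat_in_itvoo; rewrite divr_gt0.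
  rewrite in_itv/= => /andP[r0 re].
  have near (t : R) : exists q : rat, ball (ratr q : R) (ratr r) t.
    have [q] : exists q : rat, (ratr q : R) \in `]t - ratr r, t + ratr r[%R.
      by apply: rat_in_itvoo; lra.
    rewrite in_itv/= => qt; exists q.
    by rewrite /ball/= ltr_norml; lra.
  have [[qx xq] [qy yq] [qz zq]] := And3 (near x) (near y) (near z).
  exists (qx, qy, qz, r) => //; case: asboolP => [_|[]]; first by [].
  move=> [[x' y'] z'] [[/= xq' yq'] zq']; apply: pO.
  have tri (c t t' : R) : ball c (ratr r) t -> ball c (ratr r) t' -> ball t e t'.
    move=> ct ct'; apply: (@le_ball _ _ _ (ratr r + ratr r)); first lra.
    by apply: (ball_triangle _ ct'); exact: ball_sym.
  by split; [split; [exact: tri xq xq'|exact: tri yq yq']|exact: tri zq zq'].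
apply: countable_bigcupT_measurable => // q.
by case: ifP => _; [exact: mbox|exact: measurable0].
Qed.

Lemma continuous_measurable3 (G : R * R * R -> R) :
  continuous G ->
  measurable_fun setT (G : mR * mR * mR -> mR).
Proof.
move=> /continuousP cG; apply: (measurability _ (RGenOpens.measurableE R)).
move=> _ [_ [a [b ->] <-]]; rewrite setTI; apply: open_measurable3.
exact/cG/interval_open.
Qed.

(** Tonelli's theorem applies to the positive and negative parts of the
integrand extended by zero outside [0,1]. *)
Lemma measurable_mean d (T : measurableType d) (Phi : T * mR -> mR) :
  measurable_fun setT Phi -> measurable_fun setT (fun t => mean (fun z => Phi (t, z))).
Proof.
move=> mPhi; pose Psi (p : T * R) : \bar R := (Phi p * \1_(I01 : set R) p.2)%:E.
have mPsi : measurable_fun setT Psi.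
  apply/measurable_EFinP/measurable_funM => //.
  apply: (measurableT_comp (measurable_indic _)); first exact: measurable_I01.
  exact: measurable_snd.
have mp := measurable_fun_fubini_tonelli_F (m2 := mu) _ (measurable_funepos mPsi)
  (fun p => funepos_ge0 Psi p).
have mn := measurable_fun_fubini_tonelli_F (m2 := mu) _ (measurable_funeneg mPsi)
  (fun p => funeneg_ge0 Psi p).
have -> : (fun t => mean (fun z => Phi (t, z))) =
    fine \o (fubini_F mu (Psi^\+) \- fubini_F mu (Psi^\-))%E.
  apply/funext => t; rewrite /mean/Rintegral/=; congr fine.
  have E : (fun z => (Phi (t, z))%:E) \_ I01 = (fun z => Psi (t, z)).
    apply/funext => z; rewrite /patch /Psi/= indicE.
    by case: ifP => _; rewrite ?mulr1// mulr0.
  rewrite integral_mkcond E [LHS]integralE.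
  by congr (_ - _)%E; apply: eq_integral => z _; rewrite ?funeposE ?funenegE.
apply: measurableT_comp; first exact: fine_measurable.
exact: emeasurable_funB.
Qed.

Lemma ae_eq_mean f g : measurable_fun setT f -> measurable_fun setT g ->
  ae_eq mu I01 f g -> mean f = mean g.
Proof.
move=> mf mg fg; congr fine; apply: ae_eq_integral.
- exact: measurable_I01.
- by apply/measurable_EFinP; exact: measurable_funTS.
- by apply/measurable_EFinP; exact: measurable_funTS.
- by apply: filterS fg => x /= E Ix; rewrite E.
Qed.

Lemma le_norm_mean_measurable f (B : R) : measurable_fun setT f ->
  (forall y, `|f y| <= B) -> `|mean f| <= B.
Proof.
move=> mf fB; have mI := @measurable_I01 R.
have muI : (mu I01 < +oo)%E.
  by rewrite /I01 lebesgue_measure_itv/= lte_fin ltr01 -EFinB ltry.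
have int g : measurable_fun setT g -> (exists B : R, forall y, `|g y| <= B) ->
    mu.-integrable I01 (EFin \o g).
  move=> mg [C gC]; apply: measurable_bounded_integrable => //.
    exact: measurable_funTS.
  exists C; split; first exact: num_real.
  by move=> M CM y _; apply: le_trans (gC y) (ltW CM).
apply: (le_trans (le_normr_Rintegral mI (int _ mf (ex_intro _ B fB)))).
rewrite -[leRHS](@mean_cst R); apply: le_Rintegral => //.
  apply: int; first exact: measurableT_comp.
  by exists B => y; rewrite normr_id.
by apply: int => //; exists `|B|.
Qed.

Lemma bounded_Linf01 f (B : R) : measurable_fun setT f ->
  (forall y, `|f y| <= B) -> Linf01 f.
Proof.
move=> mf fB; apply/andP; split; apply/mem_set => //=.
rewrite /finite_norm unlock; case: ifPn => // _.
apply: (@le_lt_trans _ _ B%:E); last exact: ltry.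
by apply/ess_supP; apply: nearW => y; rewrite /= lee_fin.
Qed.

Lemma Linf01_measurable f : Linf01 f -> measurable_fun setT f.
Proof. by move=> fL; exact: set_mem (sub_Lfun_mfun fL). Qed.

Lemma measurable_lift3 (G : R * R * R -> R) f : continuous G ->
  measurable_fun setT f ->
  measurable_fun setT (G \o lift3 f : mR * mR * mR -> mR).
Proof.
move=> /continuous_measurable3 mG mf.
apply: (measurableT_comp (f := (G : mR * mR * mR -> mR))) => //.
apply: measurable_fun_pair; first apply: measurable_fun_pair.
- exact: measurableT_comp mf (measurableT_comp measurable_fst measurable_fst).
- exact: measurableT_comp mf (measurableT_comp measurable_snd measurable_fst).
- exact: measurableT_comp mf measurable_snd.
Qed.

(** Changing the function on a null set is harmless in the two integration
variables, one after the other, and in the free variable for almost every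
value. *)
Lemma mean2_lift3_Linf (G : R * R * R -> R) : Cb_fun3 0 G ->
  Linf_map01 (fun f => mean2 (G \o lift3 f)).
Proof.
move=> [cG [B GB] _].
have mG f : measurable_fun setT f ->
    measurable_fun setT (G \o lift3 f : mR * mR * mR -> mR).
  exact: measurable_lift3.
have minner f : measurable_fun setT f -> measurable_fun setT
    (fun p : mR * mR => mean (fun z => G (lift3 f (p.1, p.2, z)))).
  by move=> /mG /measurable_mean.
have mouter f : measurable_fun setT f -> measurable_fun setT (mean2 (G \o lift3 f)).
  by move=> /minner /measurable_mean.
have msec (x y : R) f : measurable_fun setT f ->
    measurable_fun setT (fun z : mR => G (lift3 f (x, y, z))).
  move=> /mG mGf; exact: measurableT_comp mGf (measurable_pair1 (x, y)).
have msec2 (x : R) f : measurable_fun setT f ->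
    measurable_fun setT (fun y : mR => mean (fun z => G (lift3 f (x, y, z)))).
  move=> /minner mGf; exact: measurableT_comp mGf (measurable_pair1 x).
split.
  move=> f /Linf01_measurable mf; apply: (@bounded_Linf01 _ B); first exact: mouter.
  move=> x; apply: le_norm_mean_measurable; first exact: msec2.
  by move=> y; apply: le_norm_mean_measurable; [exact: msec|move=> z; exact: GB].
move=> f g /Linf01_measurable mf /Linf01_measurable mg fg.
apply: filterS (fg) => x fgx Ix; have {}fgx := fgx Ix.
apply: ae_eq_mean; [exact: msec2|exact: msec2|].
apply: filterS (fg) => y fgy Iy; have {}fgy := fgy Iy.
apply: ae_eq_mean; [exact: msec|exact: msec|].
by apply: filterS (fg) => z fgz Iz; rewrite /lift3/= fgx fgy fgz.
Qed.

Lemma ae_I01_and (A B : mR -> Prop) :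
  {ae mu, forall x, I01 x -> A x} -> {ae mu, forall x, I01 x -> B x} ->
  {ae mu, forall x, I01 x -> A x /\ B x}.
Proof.
move=> aeA aeB; have aeF := ae_filter_ringOfSetsType mu.
apply: (@filterS2 _ _ aeF _ _ _ _ aeA aeB) => x Ax Bx Ix.
by split; [exact: Ax|exact: Bx].
Qed.

(** The interval [0,r] is not negligible, so it meets the set where an almost
sure property holds. *)
Lemma ae_I01_witness (P : R -> Prop) (r : R) : 0 < r -> r <= 1 ->
  {ae mu, forall x, I01 x -> P x} -> exists2 x, I01 x /\ x <= r & P x.
Proof.
move=> r0 r1 aeP; apply: contrapT => noP.
have : mu.-negligible (`[0, r]%classic : set mR).
  apply: negligibleS aeP => x /=; rewrite in_itv/= => /andP[x0 xr] xP.
  have Ix : I01 x by apply/I01P; lra.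
  by apply: noP; exists x => //; exact: xP.
move=> /negligibleP => /(_ (measurable_itv _)).
rewrite /= lebesgue_measure_itv/= lte_fin r0 -EFinB => /eqP.
by rewrite eqe subr0 gt_eqF.
Qed.

End EssentiallyBounded.

(** * The triplet operator *)

Section TripletOperator.
Context {R : realType}.
Local Notation mu := (@lebesgue_measure R).

Lemma tripletT_mean2 (Gamma : R -> R) (H : R -> R -> R) : tripletT Gamma H =
  fun f => mean2 ((fun p => tripletF Gamma H p.1.1 p.1.2 p.2) \o lift3 f).
Proof. by []. Qed.

(** M(u,v,w) is the sum of the values at (v,w) and (w,v) of one and the same
mixed derivative, taken first in the third and then in the second argument; this
is the order of differentiation in [mixed_difference]. *)
Lemma triplet_probes (Gamma : R -> R) (H : R -> R -> R) (u v w : R) :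
  Cb_fun1 2 Gamma -> Cb_fun2 3 H -> tripletM Gamma H u v w <> 0 ->
  exists f : bool -> bool -> R -> R,
  [/\ forall i j, continuous (f i j),
      forall i j, exists B : R, forall y, `|f i j y| <= B
    & forall kappa x, x <= 1 / 5 ->
      ~ (forall i j, pairwise_integrable kappa (f i j) x /\
           tripletT Gamma H (f i j) x = pairwise_op kappa (f i j) x)].
Proof.
move=> CGamma CH M0; pose G p := tripletF Gamma H p.1.1 p.1.2 p.2.
have CG : Cb_fun3 2 G by exact: tripletF_Cb_fun3.
have [G1 [G2 [G3 [dG _ _ C3]]]] := Cb_fun3_partials CG.
have [G31 [G32 [G33 [dG3 _ /Cb_fun3_cont cG32 _]]]] := Cb_fun3_partials C3.
have d3 (a b : R) : is_derive b 1 (fun t => G (u, a, t)) (G3 (u, a, b)).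
  by have [] := dG u a b.
have d32 (a b : R) : is_derive a 1 (fun t => G3 (u, t, b)) (G32 (u, a, b)).
  by have [] := dG3 u a b.
have ME a b : pd1 (pd2 (tripletF Gamma H u)) a b = G32 (u, a, b).
  rewrite /pd1 partial1of2E (_ : (fun t => _) = fun t => G3 (u, t, b)).
    by have [_] := d32 a b.
  by apply/funext => t; rewrite /pd2 derive1E; have [_] := d3 t b.
have cU12 : continuous (fun p : R * R => G32 (u, p.1, p.2)).
  move=> p; have cp : {for p, continuous (fun p : R * R => (u, p.1, p.2))}.
    exact: (cvg_pair (cvg_pair (cvg_cst u) cvg_fst) cvg_snd).
  have := continuous_comp cp (cG32 (u, p.1, p.2)); exact.
rewrite /tripletM !ME in M0.
have [f [cf bf fu alt sd]] := @second_difference_probes _ G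
  (fun a b => G3 (u, a, b)) (fun a b => G32 (u, a, b)) u v w
  (Cb_fun3_cont CG) d3 d32 cU12 M0.
exists f; split => // kappa x x5 rep.
have TE i j : mean2 (G \o lift3 (f i j)) x = pairwise_op kappa (f i j) x.
  by rewrite -(rep i j).2.
apply: (sd x x5); rewrite !TE.
apply: (@pairwise_second_difference _ kappa f x u) => // [i j|i j].
  exact: fu.
exact: (rep i j).1.
Qed.

End TripletOperator.

Theorem theorem5p16 (R : realType) (Gamma : R -> R) (H : R -> R -> R)
  (Gamma_Cb2 : Cb_fun1 2 Gamma)
  (Gamma_per : periodic Gamma (pi *+ 2))
  (H_Cb3 : Cb_fun2 3 H)
  (H_per1 : forall v, periodic (fun u => H u v) (pi *+ 2))
  (H_per2 : forall u, periodic (fun v => H u v) (pi *+ 2))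
  (M_neq0 : exists us vs ws : R, tripletM Gamma H us vs ws <> 0) :
  genuinely_nonpairwise (tripletT Gamma H) /\
  (Linf_map01 (tripletT Gamma H) /\
   ~ has_pairwise_kernel_Linf (tripletT Gamma H)).
Proof.
have CG := tripletF_Cb_fun3 Gamma_Cb2 H_Cb3.
have [u [v [w M0]]] := M_neq0.
have [f [cf bf no_kernel]] := triplet_probes Gamma_Cb2 H_Cb3 M0.
split; [split|split].
- by rewrite tripletT_mean2; exact: mean2_lift3_C2.
- move=> [_ [kappa [_ rep]]]; apply: (no_kernel kappa 0); first lra.
  move=> i j; apply: rep; first exact: continuous_C01.
  by apply/I01P; lra.
- by rewrite tripletT_mean2; exact/mean2_lift3_Linf/Cb_fun3S/Cb_fun3S.
move=> [kappa [_ rep]].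
have fL i j : Linf01 (f i j).
  have [B fB] := bf i j; apply: bounded_Linf01 fB.
  exact: continuous_measurable_fun.
pose P i j x := pairwise_integrable kappa (f i j) x /\
  tripletT Gamma H (f i j) x = pairwise_op kappa (f i j) x.
have aeP i j : {ae lebesgue_measure, forall x, I01 x -> P i j x}.
  by have [int eqT] := rep _ (fL i j); exact: ae_I01_and int eqT.
have [||x [_ x5] [[Ptt Ptf] [Pft Pff]]] := ae_I01_witness (r := 1 / 5) _ _
  (ae_I01_and (ae_I01_and (aeP true true) (aeP true false))
     (ae_I01_and (aeP false true) (aeP false false))); [lra|lra|].
by apply: (no_kernel kappa x x5) => -[] [].
Qed.
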